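(* Let $f,g,h,U_1,U_2$ satisfy the standing hypotheses (a)–(e) listed in the context, and let $V^{\pm}$ be the upper and lower value functions (defined in the context). Let $(t,x)\in[0,T)\times\mathbb{R}^n$ and $\bar t\in(t,T]$. Let $N:[0,\infty)\to[0,\infty)$ be a nondecreasing continuous function such that $$V^+(t,x)=\sup_{\alpha_2\in\mathcal{A}_2[t,\bar t;N(|x|)]}\ \inf_{u_1\in\mathcal{U}_1[t,\bar t;N(|x|)]}J(t,x;u_1,\alpha_2[u_1]),$$ $$V^-(t,x)=\inf_{\alpha_1\in\mathcal{A}_1[t,\bar t;N(|x|)]}\ \sup_{u_2\in\mathcal{U}_2[t,\bar t;N(|x|)]}J(t,x;\alpha_1[u_2],u_2).$$ Then $$V^+(t,x)=\sup_{\alpha_2\in\mathcal{A}_2[t,\bar t;N(|x|)]}\ \inf_{u_1\in\mathcal{U}_1[t,\bar t;N(|x|)]}\Big\{\int_t^{\bar t}g(s,y(s),u_1(s),\alpha_2[u_1](s))ds+V^+(\bar t,y(\bar t))\Big\},$$ where $y(\cdot)=y(\cdot;t,x,u_1,\alpha_2[u_1])$, and $$V^-(t,x)=\inf_{\alpha_1\in\mathcal{A}_1[t,\bar t;N(|x|)]}\ \sup_{u_2\in\mathcal{U}_2[t,\bar t;N(|x|)]}\Big\{\int_t^{\bar t}g(s,y(s),\alpha_1[u_2](s),u_2(s))ds+V^-(\bar t,y(\bar t))\Big\},$$ where $y(\cdot)=y(\cdot;t,x,\alpha_1[u_2],u_2)$.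
   Context: Notation: $\langle x\rangle=\sqrt{1+|x|^2}$; $\langle\cdot,\cdot\rangle$ with two arguments is the Euclidean inner product; $a\vee b=\max\{a,b\}$. Hypotheses. $T>0$ is fixed. There are constants $L,c,\rho_1,\rho_2>0$, $\sigma_1,\sigma_2\ge0$, $\mu\ge1$, $\mu_0,\mu_1,\mu_2\in\mathbb{R}$ such that, for all $t\in[0,T]$, $x,y\in\mathbb{R}^n$, $u_1\in U_1$, $u_2\in U_2$: (a) $U_i\subseteq\mathbb{R}^{m_i}$ is closed and $0\in U_i$, $i=1,2$. (b) $f:[0,T]\times\mathbb{R}^n\times U_1\times U_2\to\mathbb{R}^n$ is continuous, $|f(t,x,u_1,u_2)|\le L(\langle x\rangle+|u_1|^{\sigma_1}+|u_2|^{\sigma_2})$, $|f(t,x,u_1,u_2)-f(t,y,u_1,u_2)|\le[(\langle x\rangle\vee\langle y\rangle)^{\mu_0}+(\langle x\rangle\vee\langle y\rangle)^{\mu_1}|u_1|^{\sigma_1}+(\langle x\rangle\vee\langle y\rangle)^{\mu_2}|u_2|^{\sigma_2}]\,|x-y|$, and $\langle f(t,x,u_1,u_2)-f(t,y,u_1,u_2),x-y\rangle\le L|x-y|^2$. (c) $g:[0,T]\times\mathbb{R}^n\times U_1\times U_2\to\mathbb{R}$ is continuous, $c|u_1|^{\rho_1}-L(\langle x\rangle^\mu+|u_2|^{\rho_2})\le g(t,x,u_1,u_2)\le L(\langle x\rangle^\mu+|u_1|^{\rho_1})-c|u_2|^{\rho_2}$, and $|g(t,x,u_1,u_2)-g(t,y,u_1,u_2)|\le[(\langle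 x\rangle\vee\langle y\rangle)^{\mu-1}+|u_1|^{\rho_1(\mu-1)/\mu}+|u_2|^{\rho_2(\mu-1)/\mu}]\,|x-y|$. (d) $h:\mathbb{R}^n\to\mathbb{R}$ is continuous, $|h(x)-h(y)|\le L(\langle x\rangle\vee\langle y\rangle)^{\mu-1}|x-y|$ and $|h(0)|\le L$. (e) $\sigma_i\mu<\rho_i$, $i=1,2$. Game. For $t\in[0,T]$, $\mathcal{U}_i^1[t,T]$ is the set of measurable $u_i:[t,T]\to U_i$ with $\int_t^T|u_i(s)|ds<\infty$, and $\mathcal{U}_i[t,T]=\mathcal{U}_i^\infty[t,T]$ is the set of essentially bounded measurable $u_i:[t,T]\to U_i$. For $u_i\in\mathcal{U}_i[t,T]$ and $x\in\mathbb{R}^n$, $y(\cdot)=y(\cdot;t,x,u_1,u_2)$ is the solution on $[t,T]$ of $\dot y(s)=f(s,y(s),u_1(s),u_2(s))$, $y(t)=x$, and $$J(t,x;u_1,u_2)=\int_t^Tg(s,y(s),u_1(s),u_2(s))ds+h(y(T)).$$ An Elliott–Kalton strategy for Player 1 is a map $\alpha_1:\mathcal{U}_2^1[t,T]\to\mathcal{U}_1^\infty[t,T]$ that is non-anticipating: for any $u_2,\bar u_2\in\mathcal{U}^1_2[t,T]$ and $\hat t\in[t,T]$, if $u_2=\bar u_2$ a.e. on $[t,\hat t]$ then $\alpha_1[u_2]=\alpha_1[\bar u_2]$ a.e. on $[t,\hat t]$. The set of these is $\mathcal{A}_1[t,T]$. Symmetrically, $\mathcal{A}_2[t,T]$ is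 the set of non-anticipating maps $\alpha_2:\mathcal{U}_1^1[t,T]\to\mathcal{U}_2^\infty[t,T]$. The upper and lower value functions are $$V^+(t,x)=\sup_{\alpha_2\in\mathcal{A}_2[t,T]}\inf_{u_1\in\mathcal{U}_1[t,T]}J(t,x;u_1,\alpha_2[u_1]),\qquad V^-(t,x)=\inf_{\alpha_1\in\mathcal{A}_1[t,T]}\sup_{u_2\in\mathcal{U}_2[t,T]}J(t,x;\alpha_1[u_2],u_2).$$ Restricted classes. For $\bar t\in(t,T]$ and $r\geq0$, $\mathcal{U}_i[t,\bar t;r]=\{u_i\in\mathcal{U}_i[t,T]:\int_t^{\bar t}|u_i(s)|^{\rho_i}ds\le r\}$ (controls defined on all of $[t,T]$, with the integral constraint only on $[t,\bar t]$); $\mathcal{A}_1[t,\bar t;r]$ is the set of $\alpha_1\in\mathcal{A}_1[t,T]$ with $\alpha_1[u_2]\in\mathcal{U}_1[t,\bar t;r]$ for all $u_2\in\mathcal{U}_2^1[t,T]$; $\mathcal{A}_2[t,\bar t;r]$ is the set of $\alpha_2\in\mathcal{A}_2[t,T]$ with $\alpha_2[u_1]\in\mathcal{U}_2[t,\bar t;r]$ for all $u_1\in\mathcal{U}_1^1[t,T]$. *)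

(* Defs.v *)
From mathcomp Require Import all_boot all_order all_algebra.
From mathcomp Require Import all_classical all_reals all_analysis.

Set Implicit Arguments.
Unset Strict Implicit.
Unset Printing Implicit Defensive.

Import Order.TTheory GRing.Theory Num.Theory.
Import numFieldNormedType.Exports.
Local Open Scope classical_set_scope.
Local Open Scope ring_scope.

(* The library norm on 'rV[R]_n is the sup norm, hence the following.
   (Both norms induce the same topology, so continuity and closedness below
   use the library topology.) *)
Definition edot (R : realType) (n : nat) (x y : 'rV[R]_n) : R :=
  \sum_(i < n) x 0 i * y 0 i.

Definition enorm (R : realType) (n : nat) (x : 'rV[R]_n) : R :=
  Num.sqrt (edot x x).

Definition jap (R : realType) (n : nat) (x : 'rV[R]_n) : R :=
  Num.sqrt (1 + enorm x ^+ 2).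

(* The maps f and g are total functions; only their values on
   [0,T] x R^n x U1 x U2 are constrained (and used). *)
Record standing_hyps (R : realType) (n m1 m2 : nat) (T : R)
    (U1 : set 'rV[R]_m1) (U2 : set 'rV[R]_m2)
    (f : R -> 'rV[R]_n -> 'rV[R]_m1 -> 'rV[R]_m2 -> 'rV[R]_n)
    (g : R -> 'rV[R]_n -> 'rV[R]_m1 -> 'rV[R]_m2 -> R)
    (h : 'rV[R]_n -> R)
    (L c rho1 rho2 sigma1 sigma2 mu mu0 mu1 mu2 : R) : Prop := StandingHyps {
  sh_T : 0 < T;
  sh_L : 0 < L;
  sh_c : 0 < c;
  sh_rho1 : 0 < rho1;
  sh_rho2 : 0 < rho2;
  sh_sigma1 : 0 <= sigma1;
  sh_sigma2 : 0 <= sigma2;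
  sh_mu : 1 <= mu;
  sh_U1_closed : closed U1;
  sh_U1_0 : U1 0;
  sh_U2_closed : closed U2;
  sh_U2_0 : U2 0;
  sh_f_cont : {within `[0, T] `*` [set: 'rV[R]_n] `*` U1 `*` U2,
    continuous (fun p => f p.1.1.1 p.1.1.2 p.1.2 p.2)};
  sh_f_growth : forall t x u1 u2, t \in `[0, T] -> U1 u1 -> U2 u2 ->
    enorm (f t x u1 u2)
      <= L * (jap x + enorm u1 `^ sigma1 + enorm u2 `^ sigma2);
  sh_f_lip : forall t x y u1 u2, t \in `[0, T] -> U1 u1 -> U2 u2 ->
    enorm (f t x u1 u2 - f t y u1 u2)
      <= (Num.max (jap x) (jap y) `^ mu0
          + Num.max (jap x) (jap y) `^ mu1 * enorm u1 `^ sigma1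
          + Num.max (jap x) (jap y) `^ mu2 * enorm u2 `^ sigma2)
         * enorm (x - y);
  sh_f_mono : forall t x y u1 u2, t \in `[0, T] -> U1 u1 -> U2 u2 ->
    edot (f t x u1 u2 - f t y u1 u2) (x - y) <= L * enorm (x - y) ^+ 2;
  sh_g_cont : {within `[0, T] `*` [set: 'rV[R]_n] `*` U1 `*` U2,
    continuous (fun p => g p.1.1.1 p.1.1.2 p.1.2 p.2)};
  sh_g_lower : forall t x u1 u2, t \in `[0, T] -> U1 u1 -> U2 u2 ->
    c * enorm u1 `^ rho1 - L * (jap x `^ mu + enorm u2 `^ rho2)
      <= g t x u1 u2;
  sh_g_upper : forall t x u1 u2, t \in `[0, T] -> U1 u1 -> U2 u2 ->
    g t x u1 u2
      <= L * (jap x `^ mu + enorm u1 `^ rho1) - c * enorm u2 `^ rho2;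
  sh_g_lip : forall t x y u1 u2, t \in `[0, T] -> U1 u1 -> U2 u2 ->
    `|g t x u1 u2 - g t y u1 u2|
      <= (Num.max (jap x) (jap y) `^ (mu - 1)
          + enorm u1 `^ (rho1 * (mu - 1) / mu)
          + enorm u2 `^ (rho2 * (mu - 1) / mu)) * enorm (x - y);
  sh_h_cont : continuous h;
  sh_h_lip : forall x y,
    `|h x - h y| <= L * Num.max (jap x) (jap y) `^ (mu - 1) * enorm (x - y);
  sh_h_0 : `|h 0| <= L;
  sh_compat1 : sigma1 * mu < rho1;
  sh_compat2 : sigma2 * mu < rho2 }.

Section Controls.
Context (R : realType).
Local Notation leb := (@lebesgue_measure R).

(* A control on [t, T] is represented by a total function of time whose values
   outside [t, T] are irrelevant. Measurability is Borel measurability: as U is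
   closed and contains 0, every Lebesgue measurable control is almost everywhere
   equal to a Borel one. *)
Definition measurable_control (m : nat) (T : R) (U : set 'rV[R]_m) (t : R)
    (u : R -> 'rV[R]_m) : Prop :=
  (forall i, measurable_fun `[t, T] (fun s => u s 0 i)) /\
  (forall s, s \in `[t, T] -> U (u s)).

Definition controls1 (m : nat) (T : R) (U : set 'rV[R]_m) (t : R) :
    set (R -> 'rV[R]_m) :=
  [set u | measurable_control T U t u /\
     (\int[leb]_(s in `[t, T]) (enorm (u s))%:E < +oo)%E].

Definition controls (m : nat) (T : R) (U : set 'rV[R]_m) (t : R) :
    set (R -> 'rV[R]_m) :=
  [set u | measurable_control T U t u /\
     exists M : R, {ae leb, forall s, s \in `[t, T] -> enorm (u s) <= M}].

Definition controls_le (m : nat) (T : R) (U : set 'rV[R]_m) (rho t tbar r : R) :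
    set (R -> 'rV[R]_m) :=
  [set u | controls T U t u /\
     (\int[leb]_(s in `[t, tbar]) (enorm (u s) `^ rho)%:E <= r%:E)%E].

Definition eq_ae_on (m : nat) (a b : R) (u v : R -> 'rV[R]_m) : Prop :=
  {ae leb, forall s, s \in `[a, b] -> u s = v s}.

(* Elliott-Kalton strategies answering controls in U by controls in U'; taking
   that = T below, a strategy acts on almost-everywhere classes on [t, T]. *)
Definition strategies (m m' : nat) (T : R) (U : set 'rV[R]_m)
    (U' : set 'rV[R]_m') (t : R) :
    set ((R -> 'rV[R]_m) -> (R -> 'rV[R]_m')) :=
  [set alpha | (forall u, controls1 T U t u -> controls T U' t (alpha u)) /\
     (forall u v that, controls1 T U t u -> controls1 T U t v ->
        that \in `[t, T] -> eq_ae_on t that u v ->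
        eq_ae_on t that (alpha u) (alpha v))].

Definition strategies_le (m m' : nat) (T : R) (U : set 'rV[R]_m)
    (U' : set 'rV[R]_m') (rho' t tbar r : R) :
    set ((R -> 'rV[R]_m) -> (R -> 'rV[R]_m')) :=
  [set alpha | strategies T U U' t alpha /\
     forall u, controls1 T U t u -> controls_le T U' rho' t tbar r (alpha u)].

End Controls.

Section Game.
Context (R : realType) (n m1 m2 : nat) (T : R).
Context (U1 : set 'rV[R]_m1) (U2 : set 'rV[R]_m2).
Context (f : R -> 'rV[R]_n -> 'rV[R]_m1 -> 'rV[R]_m2 -> 'rV[R]_n).
Context (g : R -> 'rV[R]_n -> 'rV[R]_m1 -> 'rV[R]_m2 -> R).
Context (h : 'rV[R]_n -> R).
Local Notation leb := (@lebesgue_measure R).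

(* Caratheodory solutions on [t, T] of y' = f(s, y, u1, u2), y(t) = x. *)
Definition is_trajectory (t : R) (x : 'rV[R]_n) (u1 : R -> 'rV[R]_m1)
    (u2 : R -> 'rV[R]_m2) (y : R -> 'rV[R]_n) : Prop :=
  [/\ {within `[t, T], continuous y},
      forall i, leb.-integrable `[t, T]
        (fun s => (f s (y s) (u1 s) (u2 s) 0 i)%:E) &
      forall s i, s \in `[t, T] ->
        y s 0 i = x 0 i
          + \int[leb]_(r in `[t, s]) (f r (y r) (u1 r) (u2 r) 0 i)].

(* Under the standing hypotheses a solution exists for all essentially bounded
   controls and is unique on [t, T]; the default value is then never used. *)
Definition trajectory (t : R) (x : 'rV[R]_n) (u1 : R -> 'rV[R]_m1)
    (u2 : R -> 'rV[R]_m2) : R -> 'rV[R]_n :=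
  xget (fun=> x) [set y | is_trajectory t x u1 u2 y].

Definition running_cost (t tbar : R) (x : 'rV[R]_n) (u1 : R -> 'rV[R]_m1)
    (u2 : R -> 'rV[R]_m2) : \bar R :=
  (\int[leb]_(s in `[t, tbar])
     (g s (trajectory t x u1 u2 s) (u1 s) (u2 s))%:E)%E.

Definition payoff (t : R) (x : 'rV[R]_n) (u1 : R -> 'rV[R]_m1)
    (u2 : R -> 'rV[R]_m2) : \bar R :=
  (running_cost t T x u1 u2 + (h (trajectory t x u1 u2 T))%:E)%E.

Definition upper_value (t : R) (x : 'rV[R]_n) : \bar R :=
  ereal_sup [set ereal_inf [set payoff t x u1 (alpha2 u1)
                           | u1 in controls T U1 t]
            | alpha2 in strategies T U1 U2 t].

Definition lower_value (t : R) (x : 'rV[R]_n) : \bar R :=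
  ereal_inf [set ereal_sup [set payoff t x (alpha1 u2) u2
                           | u2 in controls T U2 t]
            | alpha1 in strategies T U2 U1 t].

End Game.

(* Main.v *)
Require Import Defs.
From mathcomp Require Import all_boot all_order all_algebra.
From mathcomp Require Import all_classical all_reals all_analysis.
From mathcomp Require Import measurable_realfun ring lra.

Import Order.TTheory GRing.Theory Num.Theory.
Import numFieldNormedType.Exports.
Local Open Scope classical_set_scope.
Local Open Scope ring_scope.

Set Implicit Arguments.
Unset Strict Implicit.
Unset Printing Implicit Defensive.

(* For essentially bounded controls the state equation has a unique
   Caratheodory solution: the Picard iterates satisfy a common exponential
   bound, hence stay in a ball on which the right-hand side is Lipschitz, and
   they contract in an exponentially weighted norm. The payoff therefore splits
   at [tbar] along the flow.

   For the upper value, freezing the control of Player 1 on [t, tbar] turns a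
   strategy on [t, T] into one on [tbar, T], which gives "<=". Conversely, a
   strategy which is good up to [tbar] is continued by a nearly optimal strategy
   on [tbar, T]. Non-anticipation allows the continuation to depend on the whole
   class modulo a.e. equality of the opponent's control on [t, tbar], so it is
   chosen separately for each class. The lower value is minus the upper value of
   the game with the players exchanged and the payoff negated. *)

(** Three points shape the details. Controls are bounded only almost everywhere, while hypotheses
    (b) and (c) are pointwise; estimates are made for truncated controls, equal to 0 where the bound
    fails, and carried back through integrals, which do not see null sets. The values are extended
    reals that are not shown to be finite, so near-optimality is expressed by a real level strictly
    between two extended reals, and only the running cost, which is finite, is moved across
    inequalities. Finally, the integral constraint of the restricted classes concerns [t, tbar]
    alone and ignores null sets, so gluing any essentially bounded control after tbar stays in the
    class; hence the tail game is unrestricted and its value is the value function at tbar. *)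

Lemma mx_norm_entry (R : realType) n (x : 'rV[R]_n) i : `|x 0 i| <= `|x|.
Proof.
rewrite [leRHS]/Num.Def.normr /= mx_normrE; apply/bigmax_geP.
by right => /=; exists (0, i).
Qed.

Lemma mx_norm_le (R : realType) n (x : 'rV[R]_n) B :
  0 <= B -> (forall i, `|x 0 i| <= B) -> `|x| <= B.
Proof.
move=> B0 xB; rewrite [leLHS]/Num.Def.normr /= mx_normrE.
apply/bigmax_leP; split => //.
by move=> [j i] _ /=; rewrite (ord1 j).
Qed.

(** Final step of every contraction argument below: a distance that can be halved any number of
    times vanishes. A positive [z] would contradict the Archimedean property, as powers of 2 exceed
    [E / z]. *)
Lemma geometric_half_le0 (R : realType) (z E : R) :
  (forall k, z <= E / 2 ^+ k) -> z <= 0.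
Proof.
move=> zE; rewrite leNgt; apply/negP => z0.
have := zE (Num.Def.archi_bound (E / z)).
have := @upper_nthrootP _ (E / z) _ (leqnn _).
set p := 2 ^+ _; have p0 : 0 < p by rewrite exprn_gt0.
rewrite ltr_pdivrMr// ler_pdivlMr// mulrC => /lt_le_trans /[apply].
by rewrite ltxx.
Qed.

Lemma geometric_half_cvg (R : realType) (u : nat -> R) (E : R) :
  (forall k, `|u k.+1 - u k| <= E / 2 ^+ k) ->
  u @ \oo --> lim (u @ \oo) /\
  forall k, `|u k - lim (u @ \oo)| <= 2 * E / 2 ^+ k.
Proof.
move=> uE.
have p0 k : 0 < 2 ^+ k :> R by rewrite exprn_gt0.
have half k : 2 * E / 2 ^+ k.+1 = E / 2 ^+ k.
  by rewrite exprS invfM mulrACA divff// mul1r.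
(* Subtracting the tail of the geometric series makes the induction on [m] close exactly. *)
have step k m : `|u (k + m)%N - u k| <= 2 * E / 2 ^+ k - 2 * E / 2 ^+ (k + m).
  elim: m => [|m ih]; first by rewrite addn0 !subrr normr0.
  rewrite addnS half.
  have -> : u (k + m).+1 - u k =
      (u (k + m).+1 - u (k + m)%N) + (u (k + m)%N - u k).
    by rewrite addrA subrK.
  rewrite (le_trans (ler_normD _ _))// (le_trans (lerD (uE _) ih))//.
  have -> : 2 * E / 2 ^+ (k + m) = E / 2 ^+ (k + m) + E / 2 ^+ (k + m).
    by rewrite -mulrDl -mulr2n mulr_natl.
  by rewrite addrCA opprD addNKr.
have E0 : 0 <= E by have := le_trans (normr_ge0 _) (uE 0); rewrite expr0 divr1.
have stepw k m : (k <= m)%N -> `|u m - u k| <= 2 * E / 2 ^+ k.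
  move=> /subnKC <-; rewrite (le_trans (step _ _))// gerBl.
  by rewrite divr_ge0 ?mulr_ge0// ltW.
have cu : u @ \oo --> lim (u @ \oo).
  apply/cauchy_cvgP/cauchyP => e e0.
  have [k _ ke] : \forall k \near \oo, 2 * E / 2 ^+ k < e.
    have : 2 * E / 2 ^+ k @[k --> \oo] --> 0.
      rewrite (_ : (fun _ => _) = geometric (2 * E) (2^-1)).
        by apply: cvg_geometric; rewrite ger0_norm// invf_lt1// ltr1n.
      by apply/funext => k /=; rewrite exprVn.
    move=> /cvgrPdist_lt /(_ _ e0); apply: filterS => k.
    by rewrite sub0r normrN; apply: le_lt_trans; rewrite ler_norm.
  exists (u k); exists k => // m /= km; rewrite /ball/= distrC.
  by apply: le_lt_trans (stepw k m km) _; apply: ke => /=.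
split => // k.
have : `|u k - u m| @[m --> \oo] --> `|u k - lim (u @ \oo)|.
  by apply: cvg_norm; apply: cvgB => //; exact: cvg_cst.
move=> cd; rewrite -(cvg_lim _ cd)//; apply: limr_le; first exact: cvgP cd.
near=> m; rewrite distrC; apply: stepw; near: m; exact: nbhs_infty_ge.
Unshelve. all: by end_near. Qed.

(** * Integrals over segments and exponential weights *)

Section segment_integrals.
Context (R : realType).
Local Notation leb := (@lebesgue_measure R).
Implicit Types (a b s B C kappa : R) (phi psi : R -> R).

Lemma bounded_integrable_segment a b phi B :
  measurable_fun `[a, b] phi -> (forall r, r \in `[a, b] -> `|phi r| <= B) ->
  leb.-integrable `[a, b] (EFin \o phi).
Proof.
move=> mphi phiB; apply: measurable_bounded_integrable => //.
  rewrite /= lebesgue_measure_itv/=.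
  by case: ifPn => // _; rewrite -EFinB ltry.
exists B; split; rewrite ?num_real// => x Bx y yab.
by apply: le_trans (phiB _ _) (ltW Bx); rewrite inE.
Qed.

Lemma integrable_subsegment a b s phi : s <= b ->
  leb.-integrable `[a, b] (EFin \o phi) -> leb.-integrable `[a, s] (EFin \o phi).
Proof.
by move=> sb; apply: integrableS => //; apply: subset_itvl; rewrite bnd_simp.
Qed.

Lemma integrable_segmentB a b phi psi :
  leb.-integrable `[a, b] (EFin \o phi) ->
  leb.-integrable `[a, b] (EFin \o psi) ->
  leb.-integrable `[a, b] (EFin \o (fun r => phi r - psi r)).
Proof. by move=> iphi ipsi; exact: integrableB iphi ipsi. Qed.

Lemma norm_Rintegral_le_cst a b phi B : a <= b ->
  leb.-integrable `[a, b] (EFin \o phi) ->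
  (forall r, r \in `[a, b] -> `|phi r| <= B) ->
  `|\int[leb]_(r in `[a, b]) phi r| <= B * (b - a).
Proof.
move=> ab iphi phiB; apply: le_trans (le_normr_Rintegral _ iphi) _ => //.
have -> : B * (b - a) = \int[leb]_(r in `[a, b]) B.
  rewrite Rintegral_cst//= lebesgue_measure_itv/= lte_fin.
  by move: ab; rewrite le_eqVlt => /predU1P[->|->]; rewrite ?ltxx// subrr.
apply: le_Rintegral => //.
- exact/integrable_norm.
- exact: (@bounded_integrable_segment _ _ (cst B) `|B|).
Qed.

Lemma continuous_expR_affine a kappa :
  continuous (fun r : R => expR (kappa * (r - a))).
Proof.
move=> r; apply: (@continuous_comp _ _ _ (fun r : R => kappa * (r - a)) expR).
  by apply: cvgM; [exact: cvg_cst|apply: cvgB; [exact: cvg_id|exact: cvg_cst]].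
exact: continuous_expR.
Qed.

Lemma integrable_expR_affine a s kappa : leb.-integrable `[a, s]
  (EFin \o (fun r : R => expR (kappa * (r - a)))).
Proof.
apply: continuous_compact_integrable; first exact: segment_compact.
by apply: continuous_subspaceT; exact: continuous_expR_affine.
Qed.

Lemma Rintegral_expR a s kappa : 0 < kappa -> a <= s ->
  \int[leb]_(r in `[a, s]) expR (kappa * (r - a)) =
  (expR (kappa * (s - a)) - 1) / kappa.
Proof.
move=> k0; rewrite le_eqVlt => /predU1P[<-|as_].
  by rewrite set_itv1 Rintegral_set1 subrr mulr0 expR0 subrr mul0r.
pose F (r : R) := expR (kappa * (r - a)) / kappa.
have dF (r : R) : is_derive r 1 F (expR (kappa * (r - a))).
  have d1 : is_derive r 1 (fun r : R => kappa * (r - a)) kappa.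
    by apply: is_derive_eq; rewrite subr0 /GRing.scale/= mulr1.
  have d2 : is_derive r 1 (fun r : R => expR (kappa * (r - a)))
                          (expR (kappa * (r - a)) * kappa).
    exact: (@is_derive1_comp _ expR (fun r : R => kappa * (r - a))).
  have -> : F = kappa^-1 \*: (fun r : R => expR (kappa * (r - a))).
    by apply/funext => q; rewrite /F mulrC.
  apply: is_derive_eq (is_deriveZ kappa^-1 d2) _.
  by rewrite /GRing.scale/= mulrC mulfK// gt_eqF.
have cF (r : R) : {for r, continuous F}.
  by apply/differentiable_continuous/derivable1_diffP; case: (dF r).
rewrite /Rintegral (@continuous_FTC2 _ _ F)//.
- by rewrite -EFinB /= /F subrr mulr0 expR0 -mulrBl.
- by apply: continuous_subspaceT; exact: continuous_expR_affine.
- split.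
  + by move=> r _; case: (dF r).
  + exact/cvg_at_right_filter/cF.
  + exact/cvg_at_left_filter/cF.
- by move=> r _; rewrite derive1E; exact: derive_val.
Qed.

(** The gain of the weighted norm: integrating a bound with weight exp(kappa (r - a)) returns the
    same weight with an extra factor 1/kappa. The [- 1] is kept for the growth bound on the Picard
    iterates, where it cancels the initial value. *)
Lemma norm_Rintegral_le_expR a b s phi C kappa : 0 < kappa ->
  a <= s -> s <= b ->
  leb.-integrable `[a, b] (EFin \o phi) ->
  (forall r, r \in `[a, b] -> `|phi r| <= C * expR (kappa * (r - a))) ->
  `|\int[leb]_(r in `[a, s]) phi r| <=
    C / kappa * (expR (kappa * (s - a)) - 1).
Proof.
move=> k0 as_ sb iphi0 phiC.
have iphi := integrable_subsegment sb iphi0.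
apply: le_trans (le_normr_Rintegral _ iphi) _ => //.
rewrite mulrAC -mulrA -Rintegral_expR// -RintegralZl//.
  apply: le_Rintegral => //.
  - exact/integrable_norm.
  - exact: (integrableZl _ C (integrable_expR_affine a s kappa)).
  - move=> r; rewrite /= in_itv/= => /andP[ar rs]; apply: phiC.
    by rewrite in_itv/= ar (le_trans rs).
exact: integrable_expR_affine.
Qed.

End segment_integrals.

(** * Existence and uniqueness for Caratheodory equations *)

Section caratheodory_equations.
Context (R : realType) (n : nat).
Local Notation leb := (@lebesgue_measure R).
Implicit Types (F : R -> 'rV[R]_n -> 'rV[R]_n) (y z : R -> 'rV[R]_n).

(** This is [is_trajectory] with both controls absorbed into the time dependence of [F]. *)
Definition caratheodory_solution F (a b : R) (x : 'rV[R]_n) y : Prop :=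
  [/\ {within `[a, b], continuous y},
      forall i, leb.-integrable `[a, b] (fun s => (F s (y s) 0 i)%:E) &
      forall s i, s \in `[a, b] ->
        y s 0 i = x 0 i + \int[leb]_(r in `[a, s]) (F r (y r) 0 i)].

Definition locally_lipschitz F (a b : R) : Prop :=
  exists K : R -> R, forall B s v w, s \in `[a, b] -> `|v| <= B -> `|w| <= B ->
    `|F s v - F s w| <= K B * `|v - w|.

Definition measurable_curve (a b : R) y : Prop :=
  forall i, measurable_fun `[a, b] (fun s => y s 0 i).

(** A positive constant is needed because the weight exponent, twice this constant, is later a
    divisor. *)
Lemma locally_lipschitz_gt0 F a b : locally_lipschitz F a b ->
  exists K : R -> R, (forall B, 0 < K B) /\
    forall B s v w, s \in `[a, b] -> `|v| <= B -> `|w| <= B ->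
      `|F s v - F s w| <= K B * `|v - w|.
Proof.
move=> [K FK]; exists (fun B => `|K B| + 1); split=> [B|B s v w sab vB wB].
  by rewrite ltr_pwDr.
apply: le_trans (FK B s v w sab vB wB) _; apply: ler_wpM2r => //.
by rewrite (le_trans (ler_norm _))// lerDl.
Qed.

Lemma within_continuous_bounded y a b : {within `[a, b], continuous y} ->
  exists B, 0 < B /\ forall s, s \in `[a, b] -> `|y s| <= B.
Proof.
move=> cy; have /compact_bounded[M [_ yM]] :=
  continuous_compact cy (@segment_compact _ a b).
exists (`|M| + 1); split; first by rewrite ltr_pwDr.
move=> s sab; apply: (yM (`|M| + 1)); last by exists s.
by rewrite (le_lt_trans (ler_norm _))// ltrDl.
Qed.

(** Both solutions stay in one ball, where [F] is Lipschitz; each substitution of the difference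
    into the integral equations halves its weighted norm. *)
Lemma caratheodory_unique F a b x y z : locally_lipschitz F a b ->
  caratheodory_solution F a b x y -> caratheodory_solution F a b x z ->
  forall s, s \in `[a, b] -> y s = z s.
Proof.
move=> /locally_lipschitz_gt0[K [K0 FK]] [cy iy ey] [cz iz ez].
have [B1 [B10 yB1]] := within_continuous_bounded cy.
have [B2 [B20 zB2]] := within_continuous_bounded cz.
(* The Lipschitz constant [K B] divided by [kappa] is 1/2, which gives the halving. *)
pose B := B1 + B2; pose kappa := 2 * K B.
have k0 : 0 < kappa by rewrite mulr_gt0.
have yB s : s \in `[a, b] -> `|y s| <= B.
  by move=> sab; rewrite (le_trans (yB1 s sab))// lerDl ltW.
have zB s : s \in `[a, b] -> `|z s| <= B.
  by move=> sab; rewrite (le_trans (zB2 s sab))// lerDr ltW.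
have B0 : 0 <= B by rewrite addr_ge0// ltW.
have Hk k s : s \in `[a, b] ->
    `|y s - z s| <= (2 * B) / 2 ^+ k * expR (kappa * (s - a)).
  elim: k s => [|k ih] s sab.
    rewrite expr0 divr1 (le_trans (ler_normB _ _))//.
    rewrite (@le_trans _ _ (2 * B))// ?mulr_natl ?mulr2n ?lerD ?yB ?zB//.
    apply: ler_peMr; first exact: addr_ge0.
    rewrite -expR0 ler_expR mulr_ge0 ?(ltW k0)// subr_ge0.
    by move: sab; rewrite in_itv/= => /andP[].
  have p0 : 0 < 2 ^+ k :> R by rewrite exprn_gt0.
  apply: mx_norm_le => [|i].
    by rewrite mulr_ge0 ?expR_ge0// divr_ge0 ?mulr_ge0// exprn_ge0.
  move: (sab); rewrite in_itv/= => /andP[as_ sb].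
  have iys := integrable_subsegment sb (iy i).
  have izs := integrable_subsegment sb (iz i).
  rewrite !mxE ey// ez// opprD addrACA subrr add0r -RintegralB//.
  have iyz := integrable_segmentB (iy i) (iz i).
  pose C := K B * ((2 * B) / 2 ^+ k).
  apply: le_trans (norm_Rintegral_le_expR (C := C) k0 as_ sb iyz _) _.
    move=> r rab; have := mx_norm_entry (F r (y r) - F r (z r)) i.
    rewrite !mxE => /le_trans; apply.
    apply: le_trans (FK B _ _ _ rab (yB r rab) (zB r rab)) _.
    by rewrite -mulrA ler_wpM2l ?(ltW (K0 _))// ih.
  rewrite -[leLHS]mulrC; set e := expR _.
  have -> : C / kappa = 2 * B / 2 ^+ k.+1.
    by rewrite /C /kappa exprS; field; rewrite !gt_eqF.
  by rewrite mulrC ler_wpM2l ?gerBl// divr_ge0 ?mulr_ge0// exprn_ge0.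
move=> s sab; apply/eqP; rewrite -subr_eq0 -normr_le0.
apply: (@geometric_half_le0 _ _ (2 * B * expR (kappa * (s - a)))) => k.
by rewrite mulrAC; exact: Hk.
Qed.

Definition integral_curve (a : R) (x : 'rV[R]_n) (v : R -> 'rV[R]_n) :=
  fun s => \row_i (x 0 i + \int[leb]_(r in `[a, s]) (v r 0 i)).

Lemma integral_curve_continuous a b x (v : R -> 'rV[R]_n) : a <= b ->
  (forall i, leb.-integrable `[a, b] (fun s => (v s 0 i)%:E)) ->
  {within `[a, b], continuous (integral_curve a x v)}.
Proof.
move=> ab iv; apply/subspace_continuousP => s sab.
apply/cvgrPdist_le => e e0.
have ci i : \forall r \near within `[a, b]%classic (nbhs s),
    `|(integral_curve a x v s - integral_curve a x v r) 0 i| <= e.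
  have /subspace_continuousP/(_ s sab)/cvgrPdist_le/(_ e e0) :=
    parameterized_integral_continuous ab (iv i).
  by apply: filterS => r; rewrite !mxE opprD addrACA subrr add0r.
apply: filterS (filter_forall _ ci) => r Hr.
by apply: mx_norm_le; [exact: ltW|].
Qed.

Lemma measurable_integral_curve a b x (v : R -> 'rV[R]_n) : a <= b ->
  (forall i, leb.-integrable `[a, b] (fun s => (v s 0 i)%:E)) ->
  measurable_curve a b (integral_curve a x v).
Proof.
move=> ab iv i; rewrite (_ : (fun _ => _) =
    (fun s => x 0 i + \int[leb]_(r in `[a, s]) (v r 0 i))); last first.
  by apply/funext => s; rewrite mxE.
apply: measurable_funD; first exact: measurable_cst.
apply: subspace_continuous_measurable_fun => //.
exact: parameterized_integral_continuous ab (iv i).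
Qed.

(** Linear growth confines all Picard iterates to one ball, so a Lipschitz constant depending on the
    radius suffices. Measurability of [F] is asked only along measurable curves, the form that
    frozen controls provide. *)
Lemma caratheodory_exists F a b x A : a <= b -> 0 < A ->
  (forall y, measurable_curve a b y -> measurable_curve a b (fun s => F s (y s))) ->
  (forall s v, s \in `[a, b] -> `|F s v| <= A * (1 + `|v|)) ->
  locally_lipschitz F a b ->
  exists y, caratheodory_solution F a b x y.
Proof.
move=> ab A0 mF FA /locally_lipschitz_gt0[K [K0 FK]].
(* The function z(s) = w exp(A (s - a)) solves z = w + A int z, hence dominates 1 + |Y_k| for each
   Picard iterate; [B] is its value at [b]. *)
pose w := 1 + `|x|; have w0 : 0 < w by rewrite ltr_pwDl.
pose B := w * expR (A * (b - a)).
have B0 : 0 < B by rewrite mulr_gt0 ?expR_gt0.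
pose kappa := 2 * K B; have k0 : 0 < kappa by rewrite mulr_gt0.
have leB s : s \in `[a, b] -> w * expR (A * (s - a)) <= B.
  rewrite in_itv/= => /andP[_ sb].
  by rewrite ler_wpM2l ?(ltW w0)// ler_expR ler_wpM2l ?(ltW A0)// lerB.
have le1e c s : 0 < c -> s \in `[a, b] -> 1 <= expR (c * (s - a)).
  rewrite in_itv/= => c0 /andP[as_ _].
  by rewrite -expR0 ler_expR mulr_ge0 ?(ltW c0)// subr_ge0.
have iF y : measurable_curve a b y -> (forall s, s \in `[a, b] -> `|y s| <= B) ->
    forall i, leb.-integrable `[a, b] (fun s => (F s (y s) 0 i)%:E).
  move=> my yB i; apply: (bounded_integrable_segment (B := A * (1 + B))).
    exact: mF.
  move=> r rab; apply: le_trans (mx_norm_entry _ _) _.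
  by apply: le_trans (FA _ _ rab) _; rewrite ler_wpM2l ?(ltW A0)// lerD2l yB.
pose Y := fix Y k := if k is k'.+1
  then integral_curve a x (fun r => F r (Y k' r)) else fun=> x.
have Yinv k : measurable_curve a b (Y k) /\
    forall s, s \in `[a, b] -> 1 + `|Y k s| <= w * expR (A * (s - a)).
  elim: k => [|k [mYk Ykb]].
    split=> [i|s sab]; first exact: measurable_cst.
    by rewrite ler_peMr ?(ltW w0) ?le1e.
  have YkB s : s \in `[a, b] -> `|Y k s| <= B.
    move=> sab; rewrite (le_trans _ (leB s sab))//.
    by rewrite (le_trans _ (Ykb s sab))// lerDr.
  have iFk := iF _ mYk YkB; split; first exact: measurable_integral_curve.
  move=> s sab; move: (sab); rewrite in_itv/= => /andP[as_ sb].
  have e1 := le1e A s A0 sab.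
  suff : `|Y k.+1 s| <= `|x| + w * (expR (A * (s - a)) - 1).
    move=> /(lerD (lexx 1)) /le_trans; apply.
    by rewrite addrA mulrBr mulr1 /w addrC subrK.
  apply: mx_norm_le => [|i].
    by rewrite addr_ge0// mulr_ge0 ?(ltW w0)// subr_ge0.
  rewrite mxE (le_trans (ler_normD _ _))// lerD ?mx_norm_entry//.
  have := norm_Rintegral_le_expR (C := A * w) A0 as_ sb (iFk i).
  rewrite (mulrAC A w A^-1) mulfV ?gt_eqF// mul1r; apply => r rab.
  apply: le_trans (mx_norm_entry _ _) _; apply: le_trans (FA _ _ rab) _.
  by rewrite -mulrA ler_wpM2l ?(ltW A0)// Ykb.
have mY k : measurable_curve a b (Y k) by case: (Yinv k).
have YB k s : s \in `[a, b] -> `|Y k s| <= B.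
  move=> sab; have [_ /(_ s sab) Yk] := Yinv k.
  by rewrite (le_trans _ (leB s sab))// (le_trans _ Yk)// lerDr.
have iFY k := iF _ (mY k) (YB k).
(* The weight at its largest, so that consecutive iterates differ by at most [E / 2 ^+ k] uniformly
   in time. *)
pose E := (2 * B) * expR (kappa * (b - a)).
(* Same halving as for uniqueness; the start uses only that two points of the ball are at distance
   at most 2B. *)
have dY k s : s \in `[a, b] ->
    `|Y k.+1 s - Y k s| <= (2 * B) / 2 ^+ k * expR (kappa * (s - a)).
  elim: k s => [|k ih] s sab.
    rewrite expr0 divr1 (le_trans (ler_normB _ _))//.
    rewrite (@le_trans _ _ (2 * B))//.
      by rewrite mulr_natl mulr2n lerD ?YB.
    by rewrite ler_peMr ?le1e// mulr_ge0// ltW.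
  apply: mx_norm_le => [|i].
    by rewrite mulr_ge0 ?expR_ge0// divr_ge0 ?mulr_ge0// ?exprn_ge0// ltW.
  move: (sab); rewrite in_itv/= => /andP[as_ sb].
  have iys := integrable_subsegment sb (iFY k.+1 i).
  have izs := integrable_subsegment sb (iFY k i).
  rewrite !mxE opprD addrACA subrr add0r -RintegralB//.
  have iyz := integrable_segmentB (iFY k.+1 i) (iFY k i).
  pose C := K B * ((2 * B) / 2 ^+ k).
  apply: le_trans (norm_Rintegral_le_expR (C := C) k0 as_ sb iyz _) _.
    move=> r rab; have := mx_norm_entry (F r (Y k.+1 r) - F r (Y k r)) i.
    rewrite !mxE => /le_trans; apply.
    apply: le_trans (FK B _ _ _ rab (YB _ _ rab) (YB _ _ rab)) _.
    by rewrite -mulrA ler_wpM2l ?(ltW (K0 _))// ih.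
  rewrite -[leLHS]mulrC; set e := expR _.
  have -> : C / kappa = 2 * B / 2 ^+ k.+1.
    by rewrite /C /kappa exprS; field; rewrite !gt_eqF.
  rewrite mulrC ler_wpM2l ?gerBl// divr_ge0 ?mulr_ge0// ?exprn_ge0//.
  exact: ltW.
have dYE s i k : s \in `[a, b] -> `|Y k.+1 s 0 i - Y k s 0 i| <= E / 2 ^+ k.
  move=> sab; have := mx_norm_entry (Y k.+1 s - Y k s) i.
  rewrite !mxE => /le_trans; apply; apply: le_trans (dY k s sab) _.
  rewrite /E [leLHS]mulrAC; apply: ler_wpM2r; first by rewrite invr_ge0 exprn_ge0.
  apply: ler_wpM2l; first by rewrite mulr_ge0// ltW.
  rewrite ler_expR; apply: ler_wpM2l; first exact: ltW.
  by move: sab; rewrite in_itv/= => /andP[_ sb]; rewrite lerB.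
pose y s : 'rV[R]_n := \row_i lim ((fun k => Y k s 0 i) @ \oo).
have Ycvg s i : s \in `[a, b] -> (fun k => Y k s 0 i) @ \oo --> y s 0 i.
  move=> sab; rewrite mxE.
  by have [] := @geometric_half_cvg _ (fun k => Y k s 0 i) E (dYE s i ^~ sab).
have E0 : 0 <= E by rewrite mulr_ge0 ?expR_ge0// mulr_ge0// ltW.
have Yy s k : s \in `[a, b] -> `|Y k s - y s| <= 2 * E / 2 ^+ k.
  move=> sab; apply: mx_norm_le => [|i].
    by rewrite divr_ge0 ?exprn_ge0// mulr_ge0.
  rewrite 3!mxE.
  by have [_] := @geometric_half_cvg _ (fun k => Y k s 0 i) E (dYE s i ^~ sab).
(* Measurability passes to the pointwise limit and makes the integrals of F(r, y(r)) meaningful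
   before continuity is known. Continuity comes last, once [y] is identified with an integral
   curve. *)
have my : measurable_curve a b y.
  move=> i; apply: (measurable_fun_cvg (h := fun k s => Y k s 0 i)) => [k|s sab].
    exact: mY.
  by apply: Ycvg.
have yB s : s \in `[a, b] -> `|y s| <= B.
  move=> sab; apply: mx_norm_le => [|i]; first exact: ltW.
  have /cvg_norm cN := Ycvg s i sab; rewrite -(cvg_lim _ cN)//.
  apply: limr_le; first exact: cvgP cN.
  by near=> k; apply: le_trans (mx_norm_entry _ _) (YB k s sab).
have iFy := iF _ my yB.
have ey s : s \in `[a, b] -> y s = integral_curve a x (fun r => F r (y r)) s.
  move=> sab; move: (sab); rewrite in_itv/= => /andP[as_ sb].
  apply/eqP; rewrite -subr_eq0 -normr_le0.
  (* The two errors are |Y_(k+1) - y| <= E / 2^k and the integral of [K B] times |Y_k - y| <= 2E /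
     2^k over a length at most b - a. *)
  apply: (@geometric_half_le0 _ _ (E + K B * (2 * E) * (b - a))) => k.
  have -> : y s - integral_curve a x (fun r => F r (y r)) s =
    - (Y k.+1 s - y s) + (Y k.+1 s - integral_curve a x (fun r => F r (y r)) s).
    by rewrite opprB addrA subrK.
  apply: le_trans (ler_normD _ _) _; rewrite mulrDl lerD//.
    rewrite normrN; apply: le_trans (Yy s k.+1 sab) _.
    by rewrite exprS -mulf_div divff ?mul1r// pnatr_eq0.
  apply: mx_norm_le => [|i].
    rewrite divr_ge0 ?exprn_ge0// mulr_ge0 ?subr_ge0//.
    by apply: mulr_ge0; [exact: ltW|exact: mulr_ge0].
  have i1 := integrable_subsegment sb (iFY k i).
  have i2 := integrable_subsegment sb (iFy i).
  rewrite !mxE opprD addrACA subrr add0r -RintegralB//.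
  have i3 := integrable_segmentB i1 i2.
  apply: le_trans (norm_Rintegral_le_cst (B := K B * (2 * E / 2 ^+ k)) as_ i3 _) _.
    move=> r; rewrite in_itv/= => /andP[ar rs].
    have rab : r \in `[a, b] by rewrite in_itv/= ar (le_trans rs).
    have := mx_norm_entry (F r (Y k r) - F r (y r)) i.
    rewrite !mxE => /le_trans; apply.
    apply: le_trans (FK B _ _ _ rab (YB _ _ rab) (yB _ rab)) _.
    by rewrite ler_wpM2l ?(ltW (K0 _))// Yy.
  rewrite [leRHS](_ : _ = K B * (2 * E / 2 ^+ k) * (b - a)); last by ring.
  rewrite ler_wpM2l ?lerB//; apply: mulr_ge0; first exact: ltW.
  by rewrite divr_ge0 ?exprn_ge0// mulr_ge0.
exists y; split=> //; last by move=> s i sab; rewrite {1}ey// mxE.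
have := integral_curve_continuous (x := x) ab iFy.
apply: subspace_eq_continuous => s; rewrite inE => sab; exact/esym/ey.
Unshelve. all: by end_near. Qed.

End caratheodory_equations.

(** * Measurability of compositions with relatively continuous functions *)

Section borel_composition.
Context (R : realType) (d : measure_display) (S : measurableType d).

Definition ball_dense (X : pseudoMetricType R) (I : Type) (q : I -> X) :=
  forall x (e : R), 0 < e -> exists i, ball x e (q i).

(** An open set is the union of the countably many balls with centre in the dense family and radius
    1/(k+1) that it contains. *)
Lemma measurable_preimage_open (X : pseudoMetricType R) (I : countType)
    (q : I -> X) (E : set S) (p : S -> X) : ball_dense q ->
  (forall i (e : R), 0 < e -> measurable (E `&` p @^-1` ball (q i) e)) ->
  forall V : set X, open V -> measurable (E `&` p @^-1` V).
Proof.
move=> dq mq V oV.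
pose e k : R := k.+1%:R^-1.
have e0 k : 0 < e k by rewrite invr_gt0.
(* Balls not contained in [V] contribute the empty set, so the union runs over a whole countable
   type. *)
pose W (ik : I * nat) := if `[< ball (q ik.1) (e ik.2) `<=` V >]
  then E `&` p @^-1` ball (q ik.1) (e ik.2) else set0.
have -> : E `&` p @^-1` V = \bigcup_ik W ik.
  apply/seteqP; split=> [s [Es Vs]|s [ik _]]; last first.
    by rewrite /W; case: asboolP => // sV [Es bs]; split=> //; exact: sV.
  have : nbhs (p s) V by exact: open_nbhs_nbhs.
  rewrite -nbhs_ballE => -[r /= r0 rV].
  pose k := Num.Def.archi_bound (2 / r).
  (* A point of the chosen ball is within two radii of [p s], hence still within [r]. *)
  have kr : e k + e k <= r.
    rewrite -mulr2n -mulr_natl ler_pdivrMr// -ler_pdivrMl// mulrC.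
    by rewrite ltW// (lt_le_trans (archi_boundP _))// ?ler_nat// divr_ge0// ltW.
  have [i bi] := dq (p s) _ (e0 k).
  exists (i, k) => //; rewrite /W/=; case: asboolP => [_|].
    by split=> //; exact: ball_sym.
  case=> z bz; apply: rV; apply: le_ball kr _ _.
  exact: ball_triangle bi bz.
apply: countable_bigcupT_measurable => // ik.
by rewrite /W; case: ifP => // _; exact: mq.
Qed.

(** Continuity of [f] and [g] is known only relative to the admissible domain [D]. The preimage of
    an open interval is the trace on [D] of an open set, and [p] maps [E] into [D], so the trace
    makes no difference. *)
Lemma measurable_comp_within (X : pseudoMetricType R) (I : countType)
    (q : I -> X) (E : set S) (D : set X) (F : X -> R) (p : S -> X) :
  ball_dense q -> measurable E -> (forall s, E s -> D (p s)) ->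
  (forall i (e : R), 0 < e -> measurable (E `&` p @^-1` ball (q i) e)) ->
  {within D, continuous F} -> measurable_fun E (F \o p).
Proof.
move=> dq mE pD mp /continuousP cF.
apply: (measurability _ (RGenOpens.measurableE R)).
move=> _ [_ [a [b ->] <-]].
have /open_subspaceP[V oV VD] :=
  cF _ (@interval_open _ (BRight a) (BLeft b) isT isT).
rewrite (_ : _ `&` _ = E `&` p @^-1` V).
  exact: measurable_preimage_open dq mp _ oV.
apply/seteqP; split=> s [Es] /= ps; split=> //.
  have [] // : (V `&` D) (p s).
  by rewrite VD; split; [exact: ps|exact: pD].
have [] // : (F @^-1` `]a, b[%classic `&` D) (p s).
by rewrite -VD; split; [exact: ps|exact: pD].
Qed.

Lemma ratr_ball_dense : ball_dense (@ratr R).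
Proof.
move=> x e e0; have /rat_in_itvoo[r] : x - e < x + e.
  by rewrite ltrBlDr -addrA ltrDl addr_gt0.
by rewrite in_itv/= => xr; exists r; rewrite /ball/= distrC ltr_distl.
Qed.

Lemma ratr_row_ball_dense n : ball_dense (fun v : 'rV[rat]_n => map_mx (@ratr R) v).
Proof.
move=> x e e0.
have /choice[r xr] : forall i, exists r : rat, ball (x 0 i) e (ratr r : R).
  by move=> i; exact: ratr_ball_dense.
exists (\row_i r i); split=> // i j; rewrite !mxE (ord1 i).
exact: xr.
Qed.

Lemma pair_ball_dense (X Y : pseudoMetricType R) (I J : Type)
    (q : I -> X) (q' : J -> Y) : ball_dense q -> ball_dense q' ->
  ball_dense (fun ij : I * J => (q ij.1, q' ij.2)).
Proof.
move=> dq dq' [x y] e e0; have [i xi] := dq x e e0; have [j yj] := dq' y e e0.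
by exists (i, j).
Qed.

Lemma measurable_preimage_ball (E : set S) (p : S -> R) (v e : R) :
  measurable E -> measurable_fun E p -> measurable (E `&` p @^-1` ball v e).
Proof. by move=> mE mp; apply: mp => //; exact: measurable_ball. Qed.

Lemma measurable_preimage_row_ball n (E : set S) (p : S -> 'rV[R]_n) v (e : R) :
  measurable E -> 0 < e -> (forall i, measurable_fun E (fun s => p s 0 i)) ->
  measurable (E `&` p @^-1` ball v e).
Proof.
move=> mE e0 mp.
rewrite (_ : _ `&` _ =
    E `&` \bigcap_(i in [set: 'I_n])
      (E `&` (fun s => p s 0 i) @^-1` ball (v 0 i) e)).
  apply: measurableI => //; apply: fin_bigcap_measurable => // i _.
  exact: measurable_preimage_ball.
apply/seteqP; split=> s [Es bs]; split=> //.
  by move=> i _; split=> //; case: bs => _ /(_ 0 i).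
by split=> // i j; rewrite (ord1 i); case: (bs j I).
Qed.

(** Balls of the product are products of balls, and balls of rows are coordinatewise, so only scalar
    measurability remains. *)
Lemma measurable_comp_within4 n m k (E : set S)
    (D : set (R * 'rV[R]_n * 'rV[R]_m * 'rV[R]_k))
    (F : R * 'rV[R]_n * 'rV[R]_m * 'rV[R]_k -> R)
    (a : S -> R) (b : S -> 'rV[R]_n) (u : S -> 'rV[R]_m) (v : S -> 'rV[R]_k) :
  measurable E -> (forall s, E s -> D (a s, b s, u s, v s)) ->
  measurable_fun E a -> (forall i, measurable_fun E (fun s => b s 0 i)) ->
  (forall i, measurable_fun E (fun s => u s 0 i)) ->
  (forall i, measurable_fun E (fun s => v s 0 i)) ->
  {within D, continuous F} ->
  measurable_fun E (fun s => F (a s, b s, u s, v s)).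
Proof.
move=> mE ED ma mb mu mv cF.
apply: (measurable_comp_within _ mE ED _ cF).
  apply: pair_ball_dense (ratr_row_ball_dense (n := k)).
  apply: pair_ball_dense (ratr_row_ball_dense (n := m)).
  exact: pair_ball_dense ratr_ball_dense (ratr_row_ball_dense (n := n)).
move=> -[[[q1 q2] q3] q4] e e0 /=.
rewrite (_ : _ `&` _ =
  (E `&` a @^-1` ball (ratr q1 : R) e) `&`
  (E `&` b @^-1` ball (map_mx ratr q2 : 'rV[R]_n) e) `&`
  (E `&` u @^-1` ball (map_mx ratr q3 : 'rV[R]_m) e) `&`
  (E `&` v @^-1` ball (map_mx ratr q4 : 'rV[R]_k) e)).
  apply: measurableI; last exact: measurable_preimage_row_ball.
  apply: measurableI; last exact: measurable_preimage_row_ball.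
  apply: measurableI; last exact: measurable_preimage_row_ball.
  exact: measurable_preimage_ball.
apply/seteqP; split=> s.
  by move=> [Es [[[]]]].
by move=> [[[[Es b1] [_ b2]] [_ b3]] [_ b4]].
Qed.

End borel_composition.

(** * Comparison of the Euclidean and sup norms *)

Section euclidean_norm.
Context (R : realType) (n : nat).
Implicit Types x : 'rV[R]_n.

Lemma edot_ge0 x : 0 <= edot x x.
Proof. by apply: sumr_ge0 => i _; rewrite -expr2 sqr_ge0. Qed.

Lemma enorm_ge0 x : 0 <= enorm x.
Proof. exact: sqrtr_ge0. Qed.

Lemma enorm0 : enorm (0 : 'rV[R]_n) = 0.
Proof. by rewrite /enorm /edot big1 ?sqrtr0// => i _; rewrite mxE mul0r. Qed.

Lemma mx_norm_le_enorm x : `|x| <= enorm x.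
Proof.
apply: mx_norm_le => [|i]; first exact: enorm_ge0.
rewrite -sqrtr_sqr /enorm ler_sqrt ?edot_ge0// /edot (bigD1 i)//= -expr2 lerDl.
by apply: sumr_ge0 => j _; rewrite -expr2 sqr_ge0.
Qed.

Lemma enorm_le_mx_norm x : enorm x <= Num.sqrt n%:R * `|x|.
Proof.
rewrite -[`|x|]ger0_norm// -sqrtr_sqr -sqrtrM ?ler0n//.
rewrite /enorm ler_sqrt ?mulr_ge0 ?sqr_ge0 ?ler0n//.
rewrite /edot -[n in n%:R]card_ord mulr_natl -sumr_const ler_sum// => i _.
by rewrite -expr2 -[leLHS]real_normK ?num_real// lerXn2r ?nnegrE// mx_norm_entry.
Qed.

Lemma jap_ge1 x : 1 <= jap x.
Proof.
by rewrite /jap -[leLHS]sqrtr1 ler_sqrt ?lerDl ?sqr_ge0// addr_ge0 ?sqr_ge0.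
Qed.

Lemma jap_le x : jap x <= 1 + enorm x.
Proof.
rewrite -[leRHS]ger0_norm ?addr_ge0 ?enorm_ge0// -sqrtr_sqr /jap.
rewrite ler_sqrt ?sqr_ge0// sqrrD expr1n lerD2r lerDl mul1r.
by rewrite mulrn_wge0 ?enorm_ge0.
Qed.

Lemma jap_le_mx_norm x B : `|x| <= B -> jap x <= 1 + Num.sqrt n%:R * B.
Proof.
move=> xB; rewrite (le_trans (jap_le x))// lerD2l.
by rewrite (le_trans (enorm_le_mx_norm x))// ler_wpM2l ?sqrtr_ge0.
Qed.

Lemma measurable_enorm (d : measure_display) (S : measurableType d) (E : set S)
    (u : S -> 'rV[R]_n) :
  (forall i, measurable_fun E (fun s => u s 0 i)) ->
  measurable_fun E (fun s => enorm (u s)).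
Proof.
move=> mu.
have msqrt : measurable_fun [set: R] (fun r : R => Num.sqrt r).
  by apply: continuous_measurable_fun; exact: sqrt_continuous.
apply: (measurableT_comp (g := fun s => edot (u s) (u s)) msqrt).
by apply: measurable_sum => i; exact: measurable_funM.
Qed.

End euclidean_norm.

(** The exponents mu0, mu1, mu2 may be negative; for a base at least 1, passing to their absolute
    values gives a bound monotone in the base. *)
Lemma powR_le_powR_norm (R : realType) (a b p : R) : 1 <= a -> a <= b ->
  a `^ p <= b `^ `|p|.
Proof.
move=> a1 ab; apply: (@le_trans _ _ (a `^ `|p|)).
  exact: ler_powR (ler_norm p).
by apply: ge0_ler_powR => //; rewrite nnegrE; lra.
Qed.

(** * Almost everywhere equality of controls *)

Section ae_equality.
Context (R : realType).
Local Notation leb := (@lebesgue_measure R).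

Lemma leb_ae_imply (P Q : R -> Prop) : (forall s, P s -> Q s) ->
  {ae leb, forall s, P s} -> {ae leb, forall s, Q s}.
Proof.
move=> PQ aeP; apply: (@filterS _ _ (ae_filter_ringOfSetsType leb) _ _ _ aeP) => s.
exact: PQ.
Qed.

Lemma leb_ae_imply2 (P Q S : R -> Prop) : (forall s, P s -> Q s -> S s) ->
  {ae leb, forall s, P s} -> {ae leb, forall s, Q s} -> {ae leb, forall s, S s}.
Proof.
move=> PQS aeP aeQ.
apply: (@filterS2 _ _ (ae_filter_ringOfSetsType leb) _ _ _ _ aeP aeQ) => s.
exact: PQS.
Qed.

Lemma eq_ae_on_sym m (a b : R) (u v : R -> 'rV[R]_m) :
  eq_ae_on a b u v -> eq_ae_on a b v u.
Proof. by apply: leb_ae_imply => s uv sab; rewrite uv. Qed.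

Lemma eq_ae_on_trans m (a b : R) (u v w : R -> 'rV[R]_m) :
  eq_ae_on a b u v -> eq_ae_on a b v w -> eq_ae_on a b u w.
Proof. by apply: leb_ae_imply2 => s uv vw sab; rewrite uv ?vw. Qed.

Lemma eq_ae_on_sub m (a b a' b' : R) (u v : R -> 'rV[R]_m) : a <= a' -> b' <= b ->
  eq_ae_on a b u v -> eq_ae_on a' b' u v.
Proof.
move=> aa' bb'; apply: leb_ae_imply => s uv; rewrite in_itv/= => /andP[as_ sb].
by apply: uv; rewrite in_itv/= (le_trans aa')// (le_trans sb).
Qed.

Lemma ae_eq_integrable (a b : R) (phi psi : R -> R) :
  measurable_fun `[a, b] psi ->
  {ae leb, forall s, s \in `[a, b] -> phi s = psi s} ->
  leb.-integrable `[a, b] (EFin \o phi) -> leb.-integrable `[a, b] (EFin \o psi).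
Proof.
move=> mpsi pp /integrableP[mphi iphi]; apply/integrableP; split.
  exact/measurable_EFinP.
have <- : (\int[leb]_(s in `[a, b]) `|(phi s)%:E| =
           \int[leb]_(s in `[a, b]) `|(psi s)%:E|)%E; last exact: iphi.
apply: ae_eq_integral => //.
- exact: measurableT_comp.
- by apply: measurableT_comp => //; exact/measurable_EFinP.
- by apply: leb_ae_imply pp => s pp sab; rewrite /= pp.
Qed.

Lemma measurable_controlS m (U : set 'rV[R]_m) (a b a' b' : R) u :
  a <= a' -> b' <= b -> measurable_control b U a u -> measurable_control b' U a' u.
Proof.
move=> aa' bb' [mu Uu].
have sub : `[a', b'] `<=` `[a, b] by apply: subset_itvScc; rewrite bnd_simp.
split=> [i|s sab]; first exact: measurable_funS (mu i).
exact/Uu/sub.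
Qed.

Lemma controlsS m (U : set 'rV[R]_m) (a b a' b' : R) u :
  a <= a' -> b' <= b -> controls b U a u -> controls b' U a' u.
Proof.
move=> aa' bb' [mu [M uM]]; split; first exact: measurable_controlS mu.
exists M; apply: leb_ae_imply uM => s uM sab; apply: uM.
have sub : `[a', b'] `<=` `[a, b] by apply: subset_itvScc; rewrite bnd_simp.
exact: sub.
Qed.

(** Redefining the control as 0, a point of [U], where the essential bound fails changes it only on
    a null subset of [a, b] and makes the bound hold at every time, as the pointwise estimates
    require. *)
Lemma controls_bounded m (U : set 'rV[R]_m) (a b : R) u : U 0 -> controls b U a u ->
  exists v M, [/\ measurable_control b U a v, 0 <= M, eq_ae_on a b u v &
    forall s, enorm (v s) <= M].
Proof.
move=> U0 [[mu Uu] [M uM]].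
exists (fun s => if enorm (u s) <= `|M| then u s else 0), `|M|; split => //.
- split=> [i|s sab]; last by case: ifP => // _; exact: Uu.
  rewrite (_ : (fun _ => _) =
      (fun s => if enorm (u s) <= `|M| then u s 0 i else 0)); last first.
    by apply/funext => s; case: ifP => // _; rewrite mxE.
  apply: measurable_fun_if => //.
  + by apply: measurable_fun_ler => //; exact: measurable_enorm.
  + by apply: measurable_funS (mu i).
- apply: leb_ae_imply uM => s uM sab; rewrite ifT//.
  by rewrite (le_trans (uM sab))// ler_norm.
- by move=> s; case: ifP => // _; rewrite enorm0.
Qed.

End ae_equality.

(** * State trajectories, running cost and payoff *)

Section trajectories.
Context (R : realType) (n m1 m2 : nat) (T : R).
Context (U1 : set 'rV[R]_m1) (U2 : set 'rV[R]_m2).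
Context (f : R -> 'rV[R]_n -> 'rV[R]_m1 -> 'rV[R]_m2 -> 'rV[R]_n).
Context (g : R -> 'rV[R]_n -> 'rV[R]_m1 -> 'rV[R]_m2 -> R).
Context (h : 'rV[R]_n -> R).
Context (L c rho1 rho2 sigma1 sigma2 mu mu0 mu1 mu2 : R).
Hypothesis hyps : standing_hyps T U1 U2 f g h
  L c rho1 rho2 sigma1 sigma2 mu mu0 mu1 mu2.
Local Notation leb := (@lebesgue_measure R).
Implicit Types (t b : R) (x : 'rV[R]_n) (y : R -> 'rV[R]_n).

Lemma itv_sub_horizon t b s : 0 <= t -> b <= T -> s \in `[t, b] -> s \in `[0, T].
Proof.
move=> t0 bT; rewrite !in_itv/= => /andP[ts sb].
by rewrite (le_trans t0)// (le_trans sb).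
Qed.

Lemma measurable_along (Phi : R -> 'rV[R]_n -> 'rV[R]_m1 -> 'rV[R]_m2 -> R)
    t b u1 u2 y :
  {within `[0, T] `*` [set: 'rV[R]_n] `*` U1 `*` U2,
    continuous (fun p => Phi p.1.1.1 p.1.1.2 p.1.2 p.2)} ->
  0 <= t -> b <= T ->
  measurable_control b U1 t u1 -> measurable_control b U2 t u2 ->
  measurable_curve t b y ->
  measurable_fun `[t, b] (fun s => Phi s (y s) (u1 s) (u2 s)).
Proof.
move=> cPhi t0 bT [mu1' Uu1] [mu2' Uu2] my.
apply: (measurable_comp_within4 (E := `[t, b]%classic) (a := idfun)
  _ _ _ my mu1' mu2' cPhi) => //.
move=> s stb; split; [split; [split|]|] => //=.
- exact: itv_sub_horizon stb.
- exact: Uu1.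
- exact: Uu2.
exact: measurable_id.
Qed.

Lemma f_coord_continuous i :
  {within `[0, T] `*` [set: 'rV[R]_n] `*` U1 `*` U2,
    continuous (fun p => f p.1.1.1 p.1.1.2 p.1.2 p.2 0 i)}.
Proof.
have cf : {within `[0, T] `*` [set: 'rV[R]_n] `*` U1 `*` U2,
    continuous (fun p => f p.1.1.1 p.1.1.2 p.1.2 p.2)}.
  exact: (sh_f_cont hyps).
move=> p; exact: (continuous_comp (cf p) (@coord_continuous _ _ _ 0 i _)).
Qed.

Lemma measurable_f_along t b u1 u2 y : 0 <= t -> b <= T ->
  measurable_control b U1 t u1 -> measurable_control b U2 t u2 ->
  measurable_curve t b y ->
  measurable_curve t b (fun s => f s (y s) (u1 s) (u2 s)).
Proof.
move=> t0 bT mu1' mu2' my i.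
apply: (@measurable_along (fun s v a a' => f s v a a' 0 i)) => //.
exact: f_coord_continuous.
Qed.

Lemma measurable_g_along t b u1 u2 y : 0 <= t -> b <= T ->
  measurable_control b U1 t u1 -> measurable_control b U2 t u2 ->
  measurable_curve t b y ->
  measurable_fun `[t, b] (fun s => g s (y s) (u1 s) (u2 s)).
Proof.
by move=> t0 bT mu1' mu2' my; apply: measurable_along => //; exact: (sh_g_cont hyps).
Qed.

Lemma within_continuous_measurable_curve t b y :
  {within `[t, b], continuous y} -> measurable_curve t b y.
Proof.
move=> cy i; apply: subspace_continuous_measurable_fun => // s.
exact: (continuous_comp (cy s) (@coord_continuous _ _ _ 0 i _)).
Qed.

Lemma powR_enorm_le m (v : 'rV[R]_m) M p : 0 <= p -> enorm v <= M ->
  enorm v `^ p <= M `^ p.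
Proof.
by move=> p0 vM; apply: ge0_ler_powR; rewrite ?nnegrE ?(le_trans _ vM) ?enorm_ge0.
Qed.

Lemma f_along_growth t b u1 u2 M1 M2 : 0 <= t -> b <= T ->
  measurable_control b U1 t u1 -> measurable_control b U2 t u2 ->
  (forall s, enorm (u1 s) <= M1) -> (forall s, enorm (u2 s) <= M2) ->
  exists A, 0 < A /\ forall s v, s \in `[t, b] ->
    `|f s v (u1 s) (u2 s)| <= A * (1 + `|v|).
Proof.
move=> t0 bT [_ Uu1] [_ Uu2] uM1 uM2.
pose C := M1 `^ sigma1 + M2 `^ sigma2.
have C0 : 0 <= C by rewrite addr_ge0 ?powR_ge0.
(* With q = sqrt n, the Japanese bracket of v is at most 1 + q|v|, and 1 + q|v| + C <= (1 + q + C)(1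
   + |v|). *)
exists (L * (1 + Num.sqrt n%:R + C)); split.
  by rewrite mulr_gt0 ?(sh_L hyps)//; have := sqrtr_ge0 (n%:R : R); lra.
move=> s v stb; rewrite (le_trans (mx_norm_le_enorm _))//.
have := sh_f_growth hyps v (itv_sub_horizon t0 bT stb) (Uu1 s stb) (Uu2 s stb).
move=> /le_trans; apply; rewrite -mulrA ler_wpM2l ?(ltW (sh_L hyps))//.
have e1 := powR_enorm_le (sh_sigma1 hyps) (uM1 s).
have e2 := powR_enorm_le (sh_sigma2 hyps) (uM2 s).
have e3 := jap_le_mx_norm (lexx `|v|).
have n0 : 0 <= Num.sqrt (n%:R : R) by exact: sqrtr_ge0.
have v0 : 0 <= `|v| by [].
rewrite -addrA (le_trans (lerD e3 (lerD e1 e2)))// -/C.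
set q := Num.sqrt _ in n0 *; set r := `|v| in v0 *.
have qr : 0 <= C * r by exact: mulr_ge0.
nra.
Qed.

Lemma f_along_lipschitz t b u1 u2 M1 M2 : 0 <= t -> b <= T ->
  measurable_control b U1 t u1 -> measurable_control b U2 t u2 ->
  (forall s, enorm (u1 s) <= M1) -> (forall s, enorm (u2 s) <= M2) ->
  locally_lipschitz (fun s v => f s v (u1 s) (u2 s)) t b.
Proof.
move=> t0 bT [_ Uu1] [_ Uu2] uM1 uM2.
(* [J B] bounds the Japanese bracket on the ball of radius [B]; the last factor sqrt n converts the
   Euclidean length of v - w into the sup norm. *)
pose J (B : R) : R := 1 + Num.sqrt n%:R * B.
exists (fun B => (J B `^ `|mu0| + J B `^ `|mu1| * M1 `^ sigma1
  + J B `^ `|mu2| * M2 `^ sigma2) * Num.sqrt n%:R) => B s v w stb vB wB.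
rewrite (le_trans (mx_norm_le_enorm _))//.
have := sh_f_lip hyps v w (itv_sub_horizon t0 bT stb) (Uu1 s stb) (Uu2 s stb).
move=> /le_trans; apply.
have e1 := powR_enorm_le (sh_sigma1 hyps) (uM1 s).
have e2 := powR_enorm_le (sh_sigma2 hyps) (uM2 s).
set a := Num.max _ _.
have a1 : 1 <= a by rewrite le_max jap_ge1.
have aJ : a <= J B by rewrite ge_max !jap_le_mx_norm.
rewrite -mulrA; apply: ler_pM; rewrite ?enorm_ge0 ?enorm_le_mx_norm//.
  by rewrite !addr_ge0 ?mulr_ge0 ?powR_ge0.
by rewrite !lerD ?ler_pM ?powR_ge0 ?powR_le_powR_norm.
Qed.

Lemma g_along_bounded t b u1 u2 M1 M2 y B : 0 <= t -> b <= T ->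
  measurable_control b U1 t u1 -> measurable_control b U2 t u2 ->
  (forall s, enorm (u1 s) <= M1) -> (forall s, enorm (u2 s) <= M2) ->
  (forall s, s \in `[t, b] -> `|y s| <= B) ->
  exists C, forall s, s \in `[t, b] -> `|g s (y s) (u1 s) (u2 s)| <= C.
Proof.
move=> t0 bT [_ Uu1] [_ Uu2] uM1 uM2 yB.
pose J : R := 1 + Num.sqrt n%:R * B.
(* The two coercive terms with factor [c] have favourable signs and are dropped. *)
exists (L * (J `^ mu + M1 `^ rho1 + M2 `^ rho2)) => s stb.
have s0T := itv_sub_horizon t0 bT stb.
have gl := sh_g_lower hyps (y s) s0T (Uu1 s stb) (Uu2 s stb).
have gu := sh_g_upper hyps (y s) s0T (Uu1 s stb) (Uu2 s stb).
have L0 := sh_L hyps; have c0 := sh_c hyps.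
have e1 := powR_enorm_le (ltW (sh_rho1 hyps)) (uM1 s).
have e2 := powR_enorm_le (ltW (sh_rho2 hyps)) (uM2 s).
have p1 := powR_ge0 (enorm (u1 s)) rho1.
have p2 := powR_ge0 (enorm (u2 s)) rho2.
have jJ : jap (y s) <= J by apply: jap_le_mx_norm; exact: yB.
have e3 : jap (y s) `^ mu <= J `^ mu.
  have j1 := jap_ge1 (y s).
  by apply: ge0_ler_powR; rewrite ?nnegrE; have := sh_mu hyps; lra.
move: gl gu e1 e2 e3 p1 p2.
set a1 := enorm (u1 s) `^ rho1; set a2 := enorm (u2 s) `^ rho2.
set a3 := jap _ `^ mu; set b1 := M1 `^ _; set b2 := M2 `^ _; set b3 := J `^ _.
move=> gl gu e1 e2 e3 p1 p2; rewrite ler_norml; apply/andP; split; nra.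
Qed.

Lemma is_trajectory_sub t b x u1 u2 y : b <= T ->
  is_trajectory T f t x u1 u2 y -> is_trajectory b f t x u1 u2 y.
Proof.
move=> bT [cy iy ey].
have sub : `[t, b] `<=` `[t, T] by apply: subset_itvl; rewrite bnd_simp.
split; first exact: continuous_subspaceW cy.
- by move=> i; exact: integrable_subsegment (iy i).
- by move=> s i stb; apply: ey; exact: sub.
Qed.

Lemma is_trajectory_shift t b x u1 u2 y : t <= b -> b <= T ->
  is_trajectory T f t x u1 u2 y -> is_trajectory T f b (y b) u1 u2 y.
Proof.
move=> tb bT [cy iy ey].
have sub : `[b, T] `<=` `[t, T] by apply: subset_itvr; rewrite bnd_simp.
split; first exact: continuous_subspaceW cy.
- by move=> i; apply: integrableS (iy i).
- move=> s i; rewrite in_itv/= => /andP[bs sT].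
  have iys := integrable_subsegment sT (iy i).
  rewrite !ey ?in_itv/= ?tb ?bT ?(le_trans tb bs)// -addrA; congr (_ + _).
  apply/eqP; rewrite addrC -subr_eq; apply/eqP.
  rewrite Rintegral_itvB// ?bnd_simp//.
  rewrite Rintegral_itv_obnd_cbnd//.
  by apply: integrableS iys => //; apply: subset_itv; rewrite bnd_simp.
Qed.

(** Controls enter the state equation only under the integral sign. *)
Lemma is_trajectory_ae t b x u1 u2 v1 v2 y : 0 <= t -> b <= T ->
  measurable_control b U1 t u1 -> measurable_control b U2 t u2 ->
  measurable_control b U1 t v1 -> measurable_control b U2 t v2 ->
  eq_ae_on t b u1 v1 -> eq_ae_on t b u2 v2 ->
  is_trajectory b f t x u1 u2 y -> is_trajectory b f t x v1 v2 y.
Proof.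
move=> t0 bT mcu1 mcu2 mcv1 mcv2 uv1 uv2 [cy iy ey].
have my := within_continuous_measurable_curve cy.
have mfv := measurable_f_along t0 bT mcv1 mcv2 my.
have fuv i : {ae leb, forall s, s \in `[t, b] ->
    f s (y s) (u1 s) (u2 s) 0 i = f s (y s) (v1 s) (v2 s) 0 i}.
  by apply: leb_ae_imply2 uv1 uv2 => s e1 e2 stb; rewrite e1 ?e2.
have ify i : leb.-integrable `[t, b] (fun s => (f s (y s) (v1 s) (v2 s) 0 i)%:E).
  by apply: ae_eq_integrable (fuv i) (iy i); exact: mfv.
split=> // s i stb; rewrite ey//; congr (_ + fine _).
have sb : s <= b by move: stb; rewrite in_itv/= => /andP[].
apply: ae_eq_integral => //.
- exact: measurable_int (integrable_subsegment sb (iy i)).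
- exact: measurable_int (integrable_subsegment sb (ify i)).
- apply: leb_ae_imply (fuv i) => r e; rewrite /= in_itv/= => /andP[tr rs].
  by rewrite e// in_itv/= tr (le_trans rs).
Qed.

Lemma trajectory_exists t x u1 u2 : 0 <= t -> t <= T ->
  controls T U1 t u1 -> controls T U2 t u2 ->
  is_trajectory T f t x u1 u2 (trajectory T f t x u1 u2).
Proof.
move=> t0 tT cu1 cu2.
suff [y yP] : exists y, is_trajectory T f t x u1 u2 y.
  exact: (xgetPex (fun=> x) (ex_intro (is_trajectory T f t x u1 u2) y yP)).
have [v1 [M1 [mv1 _ e1 v1M]]] := controls_bounded (sh_U1_0 hyps) cu1.
have [v2 [M2 [mv2 _ e2 v2M]]] := controls_bounded (sh_U2_0 hyps) cu2.
have TT := lexx T.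
have [A [A0 fA]] := f_along_growth t0 TT mv1 mv2 v1M v2M.
have fL := f_along_lipschitz t0 TT mv1 mv2 v1M v2M.
have fm y := measurable_f_along (y := y) t0 TT mv1 mv2.
have [y yP] := caratheodory_exists x tT A0 fm fA fL.
exists y; apply: (is_trajectory_ae t0 TT mv1 mv2) => //.
- by case: cu1.
- by case: cu2.
- exact: eq_ae_on_sym.
- exact: eq_ae_on_sym.
Qed.

Lemma is_trajectory_unique t b x u1 u2 y z : 0 <= t -> b <= T ->
  controls b U1 t u1 -> controls b U2 t u2 ->
  is_trajectory b f t x u1 u2 y -> is_trajectory b f t x u1 u2 z ->
  forall s, s \in `[t, b] -> y s = z s.
Proof.
move=> t0 bT cu1 cu2 yP zP.
have [v1 [M1 [mv1 _ e1 v1M]]] := controls_bounded (sh_U1_0 hyps) cu1.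
have [v2 [M2 [mv2 _ e2 v2M]]] := controls_bounded (sh_U2_0 hyps) cu2.
have fL := f_along_lipschitz t0 bT mv1 mv2 v1M v2M.
case: cu1 => mcu1 _; case: cu2 => mcu2 _.
have yv := is_trajectory_ae t0 bT mcu1 mcu2 mv1 mv2 e1 e2 yP.
have zv := is_trajectory_ae t0 bT mcu1 mcu2 mv1 mv2 e1 e2 zP.
exact: caratheodory_unique fL yv zv.
Qed.

(** The state up to [b] ignores controls after [b]: both trajectories, restricted to [t, b], solve
    the same equation there, and uniqueness is applied on [t, b] rather than on [t, T]. *)
Lemma trajectory_prefix t b x u1 u2 v1 v2 : 0 <= t -> t <= b -> b <= T ->
  controls T U1 t u1 -> controls T U2 t u2 ->
  controls T U1 t v1 -> controls T U2 t v2 ->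
  eq_ae_on t b u1 v1 -> eq_ae_on t b u2 v2 ->
  forall s, s \in `[t, b] ->
    trajectory T f t x u1 u2 s = trajectory T f t x v1 v2 s.
Proof.
move=> t0 tb bT cu1 cu2 cv1 cv2 e1 e2.
have tT := le_trans tb bT.
have uP := is_trajectory_sub bT (trajectory_exists x t0 tT cu1 cu2).
have vP := is_trajectory_sub bT (trajectory_exists x t0 tT cv1 cv2).
have cv1' := controlsS (lexx t) bT cv1; have cv2' := controlsS (lexx t) bT cv2.
apply: (is_trajectory_unique t0 bT cv1' cv2' _ vP).
case: (controlsS (lexx t) bT cu1) => mcu1 _.
case: (controlsS (lexx t) bT cu2) => mcu2 _.
case: cv1' => mcv1 _; case: cv2' => mcv2 _.
exact: (is_trajectory_ae t0 bT mcu1 mcu2 mcv1 mcv2 e1 e2 uP).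
Qed.

Lemma trajectory_flow t b x u1 u2 : 0 <= t -> t <= b -> b <= T ->
  controls T U1 t u1 -> controls T U2 t u2 ->
  forall s, s \in `[b, T] -> trajectory T f t x u1 u2 s =
    trajectory T f b (trajectory T f t x u1 u2 b) u1 u2 s.
Proof.
move=> t0 tb bT cu1 cu2.
have b0 := le_trans t0 tb; have tT := le_trans tb bT.
have cu1' := controlsS tb (lexx T) cu1; have cu2' := controlsS tb (lexx T) cu2.
have uP := is_trajectory_shift tb bT (trajectory_exists x t0 tT cu1 cu2).
apply: (is_trajectory_unique b0 (lexx T) cu1' cu2' uP).
exact: trajectory_exists.
Qed.

(** Along truncated controls [g] is bounded on the compact range of the trajectory; a.e. equality
    carries integrability back. *)
Lemma integrable_running t x u1 u2 : 0 <= t -> t <= T ->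
  controls T U1 t u1 -> controls T U2 t u2 ->
  leb.-integrable `[t, T]
    (fun s => (g s (trajectory T f t x u1 u2 s) (u1 s) (u2 s))%:E).
Proof.
move=> t0 tT cu1 cu2; have TT := lexx T.
have [cy _ _] := trajectory_exists x t0 tT cu1 cu2.
set y := trajectory _ _ _ _ _ _ in cy *.
have [v1 [M1 [mv1 _ e1 v1M]]] := controls_bounded (sh_U1_0 hyps) cu1.
have [v2 [M2 [mv2 _ e2 v2M]]] := controls_bounded (sh_U2_0 hyps) cu2.
have [B [B0 yB]] := within_continuous_bounded cy.
have my := within_continuous_measurable_curve cy.
have [C gC] := g_along_bounded t0 TT mv1 mv2 v1M v2M yB.
case: cu1 => mcu1 _; case: cu2 => mcu2 _.
have mgu := measurable_g_along t0 TT mcu1 mcu2 my.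
have mgv := measurable_g_along t0 TT mv1 mv2 my.
apply: ae_eq_integrable (bounded_integrable_segment mgv gC) => //.
by apply: leb_ae_imply2 e1 e2 => s e1 e2 stT; rewrite e1 ?e2.
Qed.

Local Notation running := (running_cost T f g).
Local Notation pay := (payoff T f g h).

Lemma running_cost_fin_num t b x u1 u2 : 0 <= t -> t <= b -> b <= T ->
  controls T U1 t u1 -> controls T U2 t u2 ->
  running t b x u1 u2 \is a fin_num.
Proof.
move=> t0 tb bT cu1 cu2.
apply: integrable_fin_num => //.
have iy := integrable_running x t0 (le_trans tb bT) cu1 cu2.
exact: integrable_subsegment iy.
Qed.

Lemma ae_eq_running t b (y z : R -> 'rV[R]_n) u1 u2 v1 v2 :
  t <= b -> b <= T ->
  leb.-integrable `[t, b] (fun s => (g s (y s) (u1 s) (u2 s))%:E) ->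
  leb.-integrable `[t, b] (fun s => (g s (z s) (v1 s) (v2 s))%:E) ->
  eq_ae_on t b u1 v1 -> eq_ae_on t b u2 v2 ->
  (forall s, s \in `[t, b] -> y s = z s) ->
  (\int[leb]_(s in `[t, b]) (g s (y s) (u1 s) (u2 s))%:E =
   \int[leb]_(s in `[t, b]) (g s (z s) (v1 s) (v2 s))%:E)%E.
Proof.
move=> tb bT iu iv e1 e2 yz; apply: ae_eq_integral => //.
- exact: measurable_int iu.
- exact: measurable_int iv.
- by apply: leb_ae_imply2 e1 e2 => s e1 e2 stb; rewrite e1 ?e2 ?yz.
Qed.

Lemma running_cost_prefix t b x u1 u2 v1 v2 : 0 <= t -> t <= b -> b <= T ->
  controls T U1 t u1 -> controls T U2 t u2 ->
  controls T U1 t v1 -> controls T U2 t v2 ->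
  eq_ae_on t b u1 v1 -> eq_ae_on t b u2 v2 ->
  running t b x u1 u2 = running t b x v1 v2.
Proof.
move=> t0 tb bT cu1 cu2 cv1 cv2 e1 e2; have tT := le_trans tb bT.
apply: ae_eq_running => //; last exact: trajectory_prefix.
- exact: integrable_subsegment (integrable_running x t0 tT cu1 cu2).
- exact: integrable_subsegment (integrable_running x t0 tT cv1 cv2).
Qed.

Lemma payoff_ae t x u1 u2 v1 v2 : 0 <= t -> t <= T ->
  controls T U1 t u1 -> controls T U2 t u2 ->
  controls T U1 t v1 -> controls T U2 t v2 ->
  eq_ae_on t T u1 v1 -> eq_ae_on t T u2 v2 ->
  pay t x u1 u2 = pay t x v1 v2.
Proof.
move=> t0 tT cu1 cu2 cv1 cv2 e1 e2; rewrite /payoff.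
rewrite (running_cost_prefix x t0 tT (lexx T) cu1 cu2 cv1 cv2 e1 e2).
rewrite (trajectory_prefix x t0 tT (lexx T) cu1 cu2 cv1 cv2 e1 e2)//.
by rewrite in_itv/= tT lexx.
Qed.

Lemma payoff_split t b x u1 u2 : 0 <= t -> t <= b -> b <= T ->
  controls T U1 t u1 -> controls T U2 t u2 ->
  pay t x u1 u2 =
    (running t b x u1 u2 + pay b (trajectory T f t x u1 u2 b) u1 u2)%E.
Proof.
move=> t0 tb bT cu1 cu2.
have tT := le_trans tb bT; have b0 := le_trans t0 tb.
have iy := integrable_running x t0 tT cu1 cu2.
have cu1' := controlsS tb (lexx T) cu1; have cu2' := controlsS tb (lexx T) cu2.
have iz := integrable_running (trajectory T f t x u1 u2 b) b0 bT cu1' cu2'.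
have fl := trajectory_flow x t0 tb bT cu1 cu2.
rewrite /payoff addeA -fl ?in_itv/= ?bT ?lexx//; congr (_ + _)%E.
(* The second piece is half-open for disjointness; the point [b] is put back afterwards, being
   null. *)
have split_itv : `[t, T]%classic = `[t, b] `|` `]b, T].
  by apply: itv_bndbnd_setU; rewrite bnd_simp.
have iy' : leb.-integrable `[b, T]
    (fun s => (g s (trajectory T f t x u1 u2 s) (u1 s) (u2 s))%:E).
  by apply: integrableS iy => //; apply: subset_itvr; rewrite bnd_simp.
rewrite /running_cost [in LHS]split_itv integral_setU_EFin//; first last.
- apply/disj_setPS => s [/=]; rewrite !in_itv/= => /andP[_ sb] /andP[].
  by rewrite ltNge sb.
- by rewrite -split_itv; apply/measurable_EFinP; exact: measurable_int iy.
congr (_ + _)%E.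
rewrite integral_itv_obnd_cbnd; last first.
  apply: measurable_funS (measurable_int leb iy') => //.
  exact: subset_itv_oc_cc.
by apply: eq_integral => s; rewrite inE => sbT; rewrite fl.
Qed.

End trajectories.

(** * Concatenation of controls at an intermediate time *)

Section concatenation.
Context (R : realType).
Local Notation leb := (@lebesgue_measure R).

(** The value at [b] is taken from [v]: agreement with [u] on [t, b] can fail only at the single
    point [b], while agreement with [v] from [b] on holds everywhere. *)
Definition concat m (b : R) (u v : R -> 'rV[R]_m) : R -> 'rV[R]_m :=
  fun s => if s < b then u s else v s.

Context (m : nat) (T : R) (U : set 'rV[R]_m).
Implicit Types (t b : R) (u v : R -> 'rV[R]_m).

Lemma eq_ae_on_concatl t b u v : eq_ae_on t b (concat b u v) u.
Proof.
exists [set b]; split; [exact: measurable_set1|exact: lebesgue_measure_set1|].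
move=> s /= /not_implyP[]; rewrite in_itv/= => /andP[_]; rewrite le_eqVlt.
by move=> /predU1P[//|sb]; rewrite /concat sb.
Qed.

Lemma eq_ae_on_concatr b u v : eq_ae_on b T (concat b u v) v.
Proof.
apply: aeW => s; rewrite in_itv/= => /andP[bs _].
by rewrite /concat ltNge bs.
Qed.

Lemma eq_ae_on_concat t b e u u' v v' : t <= b -> b <= e ->
  eq_ae_on t b u u' -> eq_ae_on b e v v' ->
  eq_ae_on t e (concat b u v) (concat b u' v').
Proof.
move=> tb be; apply: leb_ae_imply2 => s uu' vv'; rewrite in_itv/= => /andP[ts se].
rewrite /concat; case: ltP => sb.
  by apply: uu'; rewrite in_itv/= ts ltW.
by apply: vv'; rewrite in_itv/= sb.
Qed.

Lemma measurable_control_concat t b u v : t <= b -> b <= T ->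
  measurable_control T U t u -> measurable_control T U b v ->
  measurable_control T U t (concat b u v).
Proof.
move=> tb bT [mu Uu] [mv Uv]; split=> [i|s]; last first.
  rewrite in_itv/= => /andP[ts sT]; rewrite /concat; case: ltP => sb.
    by apply: Uu; rewrite in_itv/= ts.
  by apply: Uv; rewrite in_itv/= sb.
rewrite (_ : (fun _ => _) =
    (fun s => if s < b then u s 0 i else v s 0 i)); last first.
  by apply/funext => s; rewrite /concat; case: ifP.
apply: measurable_fun_if => //.
- exact: measurable_fun_ltr.
- by apply: measurable_funS (mu i) => // s [].
- apply: measurable_funS (mv i) => // s [/=]; rewrite !in_itv/= => /andP[_ sT].
  by move=> /negbT; rewrite -leNgt => ->.
Qed.

Lemma controls_concat t b u v : t <= b -> b <= T ->
  controls T U t u -> controls T U b v -> controls T U t (concat b u v).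
Proof.
move=> tb bT [mu [M uM]] [mv [M' vM]].
split; first exact: measurable_control_concat.
exists (Num.max M M'); apply: leb_ae_imply2 uM vM => s uM vM.
rewrite in_itv/= => /andP[ts sT]; rewrite /concat; case: ltP => sb.
  by rewrite le_max uM// in_itv/= ts.
by rewrite le_max orbC vM// in_itv/= sb.
Qed.

Lemma measurable_enorm_EFin t u : measurable_control T U t u ->
  measurable_fun `[t, T] (fun s => (enorm (u s))%:E).
Proof. by move=> [mu _]; apply/measurable_EFinP; exact: measurable_enorm. Qed.

Lemma controls1S t b u : t <= b -> controls1 T U t u -> controls1 T U b u.
Proof.
move=> tb [mu iu]; split; first exact: measurable_controlS mu.
apply: le_lt_trans iu; apply: ge0_subset_integral => //.
- exact: measurable_enorm_EFin.
- by move=> s _; rewrite lee_fin enorm_ge0.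
- by apply: subset_itvr; rewrite bnd_simp.
Qed.

Lemma controls1_concat t b u v : t <= b -> b <= T ->
  controls1 T U t u -> controls1 T U b v -> controls1 T U t (concat b u v).
Proof.
move=> tb bT [mu iu] [mv iv].
have mw := measurable_control_concat tb bT mu mv; split=> //.
have split_itv : `[t, T]%classic = `[t, b[ `|` `[b, T].
  by apply: itv_bndbnd_setU; rewrite bnd_simp.
have mew := measurable_enorm_EFin mw.
have eu_ge0 w s : (0 <= (enorm (w s : 'rV[R]_m))%:E)%E by rewrite lee_fin enorm_ge0.
rewrite split_itv ge0_integral_setU//; last 2 first.
- by rewrite -split_itv.
- apply/disj_setPS => s [/=]; rewrite !in_itv/= => /andP[_ sb] /andP[bs].
  by rewrite leNgt sb in bs.
apply: lte_add_pinfty.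
  have -> : (\int[leb]_(s in `[t, b[) (enorm (concat b u v s))%:E =
             \int[leb]_(s in `[t, b[) (enorm (u s))%:E)%E.
    apply: eq_integral => s; rewrite inE/= in_itv/= => /andP[_ sb].
    by rewrite /concat sb.
  apply: le_lt_trans iu; apply: ge0_subset_integral => //.
    exact: measurable_enorm_EFin.
  by apply: subset_itvl; rewrite bnd_simp.
have -> // : (\int[leb]_(s in `[b, T]) (enorm (concat b u v s))%:E =
              \int[leb]_(s in `[b, T]) (enorm (v s))%:E)%E.
apply: eq_integral => s; rewrite inE/= in_itv/= => /andP[bs _].
by rewrite /concat ltNge bs.
Qed.

Lemma cst0_controls t : U 0 -> controls T U t (fun=> 0).
Proof.
move=> U0; split; first by split=> // i; exact: measurable_cst.
by exists 0; apply: aeW => s _; rewrite enorm0.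
Qed.

Lemma controls_controls1 t u : controls T U t u -> controls1 T U t u.
Proof.
move=> [mu [M uM]]; split=> //.
apply: (@le_lt_trans _ _ (\int[leb]_(s in `[t, T]) `|M|%:E)%E).
  apply: ae_ge0_le_integral => //.
  - by move=> s _; rewrite lee_fin enorm_ge0.
  - exact: measurable_enorm_EFin.
  - apply: leb_ae_imply uM => s uM sab; rewrite lee_fin.
    by rewrite (le_trans (uM sab))// ler_norm.
rewrite integral_cst//= lebesgue_measure_itv/=.
by case: ifPn => _; rewrite ?mule0// -EFinB -EFinM ltry.
Qed.

(** Lets a control be changed freely after [b] without leaving the restricted class. *)
Lemma controls_le_ae t b rho r u v : b <= T -> 
  eq_ae_on t b u v -> controls T U t v ->
  controls_le T U rho t b r u -> controls_le T U rho t b r v.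
Proof.
move=> bT uv cv [cu iu]; split; first exact: cv.
have mpow w : measurable_control b U t w ->
    measurable_fun `[t, b] (fun s => (enorm (w s) `^ rho)%:E).
  move=> [mw _]; apply/measurable_EFinP.
  exact: (measurableT_comp (measurable_powR rho) (measurable_enorm mw)).
have -> : (\int[leb]_(s in `[t, b]) (enorm (v s) `^ rho)%:E =
           \int[leb]_(s in `[t, b]) (enorm (u s) `^ rho)%:E)%E; last exact: iu.
apply: ae_eq_integral; first exact: measurable_itv.
- by apply: mpow; case: (controlsS (lexx t) bT cv).
- by apply: mpow; case: (controlsS (lexx t) bT cu).
- by apply: leb_ae_imply uv => s uv stb; rewrite uv.
Qed.

End concatenation.

Lemma ereal_lt_dense (R : realType) (x y : \bar R) : (x < y)%E ->
  exists w : R, (x < w%:E < y)%E.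
Proof.
case: x => [x| |]; case: y => [y| |] //=.
- rewrite lte_fin => xy; exists ((x + y) / 2); rewrite !lte_fin.
  by apply/andP; split; lra.
- by move=> _; exists (x + 1); rewrite lte_fin ltry andbT ltrDl.
- by move=> _; exists (y - 1); rewrite lte_fin ltNyr/= gtrDl oppr_lt0.
- by move=> _; exists 0; rewrite ltNyr ltry.
Qed.

(** * Tails and gluing of non-anticipating strategies *)

Section strategies.
Context (R : realType) (m m' : nat) (T : R).
Context (U : set 'rV[R]_m) (U' : set 'rV[R]_m').
Implicit Types (t b : R) (alpha : (R -> 'rV[R]_m) -> (R -> 'rV[R]_m')).

Lemma tail_strategy t b alpha u : t <= b -> b <= T ->
  strategies T U U' t alpha -> controls1 T U t u ->
  strategies T U U' b (fun v => alpha (concat b u v)).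
Proof.
move=> tb bT [cal nal] cu; split=> [v cv|v w e cv cw].
  by apply: (controlsS tb (lexx T)); apply: cal; exact: controls1_concat.
rewrite in_itv/= => /andP[be eT] vw; apply: (eq_ae_on_sub tb (lexx e)).
apply: nal; [exact: controls1_concat..| |].
  by rewrite in_itv/= (le_trans tb).
by apply: eq_ae_on_concat => //; exact: aeW.
Qed.

(* The continuation is selected by a key which depends only on the class of
   the opponent's control on [t, b], which keeps the strategy non-anticipating. *)
Lemma glued_strategy (K : Type) t b alpha
    (beta : K -> (R -> 'rV[R]_m) -> (R -> 'rV[R]_m')) (key : (R -> 'rV[R]_m) -> K) :
  t <= b -> b <= T -> strategies T U U' t alpha ->
  (forall k, strategies T U U' b (beta k)) ->
  (forall u v, eq_ae_on t b u v -> key u = key v) ->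
  strategies T U U' t (fun u => concat b (alpha u) (beta (key u) u)).
Proof.
move=> tb bT [cal nal] sbeta keyE; split=> [u cu|u v e cu cv].
  apply: controls_concat => //; first exact: cal.
  by apply: (sbeta _).1; exact: controls1S cu.
(* Up to [b] only [alpha] is visible. Beyond [b] the two controls agree on all of [t, b], so their
   keys coincide and one and the same continuation is compared. *)
rewrite in_itv/= => /andP[te eT] uv; case: (leP e b) => [eb|/ltW be].
  have concatl w w' : eq_ae_on t e (concat b w w' : R -> 'rV[R]_m') w.
    exact: eq_ae_on_sub (lexx t) eb (@eq_ae_on_concatl _ _ t b w w').
  apply: eq_ae_on_trans (concatl _ _) _.
  apply: eq_ae_on_trans _ (eq_ae_on_sym (concatl _ _)).
  by apply: nal => //; rewrite in_itv/= te.
have uvb := eq_ae_on_sub (lexx t) be uv.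
rewrite (keyE u v)//; apply: eq_ae_on_concat => //.
  by apply: nal => //; rewrite in_itv/= tb.
apply: (sbeta _).2; [exact: controls1S tb _..| |].
  by rewrite in_itv/= be.
exact: (eq_ae_on_sub tb (lexx e)).
Qed.

End strategies.

(** * Dynamic programming for the upper value *)

Section dynamic_programming.
Context (R : realType) (n m1 m2 : nat) (T : R).
Context (U1 : set 'rV[R]_m1) (U2 : set 'rV[R]_m2).
Context (f : R -> 'rV[R]_n -> 'rV[R]_m1 -> 'rV[R]_m2 -> 'rV[R]_n).
Context (g : R -> 'rV[R]_n -> 'rV[R]_m1 -> 'rV[R]_m2 -> R).
Context (h : 'rV[R]_n -> R).
Context (L c rho1 rho2 sigma1 sigma2 mu mu0 mu1 mu2 : R).
Hypothesis hyps : standing_hyps T U1 U2 f g h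
  L c rho1 rho2 sigma1 sigma2 mu mu0 mu1 mu2.
Local Notation running := (running_cost T f g).
Local Notation pay := (payoff T f g h).
Local Notation traj := (trajectory T f).
Local Notation V := (upper_value T U1 U2 f g h).

Variables (t b r : R) (x : 'rV[R]_n).
Hypotheses (t0 : 0 <= t) (tb : t <= b) (bT : b <= T).

Lemma inf_payoff_le_tail alpha u1 :
  strategies T U1 U2 t alpha -> controls_le T U1 rho1 t b r u1 ->
  (ereal_inf [set pay t x v1 (alpha v1) | v1 in controls_le T U1 rho1 t b r] <=
   running t b x u1 (alpha u1) + V b (traj t x u1 (alpha u1) b))%E.
Proof.
move=> sal u1le; have [cu1 _] := u1le; have [cal nal] := sal.
have c1u1 := controls_controls1 cu1; have cau1 := cal _ c1u1.
have rfin := running_cost_fin_num hyps x t0 tb bT cu1 cau1.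
rewrite -leeBlDl//; set z := traj _ _ _ _ _.
have sbeta := tail_strategy tb bT sal c1u1.
(* The tail of [alpha] after [u1] is one competitor in the supremum defining [V b z]; each reply [v]
   to it is then glued after [u1]. *)
apply: le_trans (ereal_sup_ubound (ex_intro2 _ _ _ sbeta erefl)).
apply: le_ereal_inf_tmp => _ [v cv <-]; rewrite leeBlDl//.
pose w := concat b u1 v.
have cw : controls T U1 t w by exact: controls_concat.
have caw := cal _ (controls_controls1 cw).
have wu1 : eq_ae_on t b w u1 by exact: eq_ae_on_concatl.
(* Non-anticipation makes the head of the play, hence the state [z] at [b], the same for every
   [v]. *)
have awu1 : eq_ae_on t b (alpha w) (alpha u1).
  by apply: nal => //; [exact: controls_controls1|rewrite in_itv/= tb].
have wle : controls_le T U1 rho1 t b r w.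
  exact: (controls_le_ae bT (eq_ae_on_sym wu1) cw u1le).
apply: le_trans (ereal_inf_lbound (ex_intro2 _ _ _ wle erefl)) _.
rewrite (payoff_split hyps x t0 tb bT cw caw).
rewrite (running_cost_prefix hyps x t0 tb bT cw caw cu1 cau1 wu1 awu1).
rewrite (trajectory_prefix hyps x t0 tb bT cw caw cu1 cau1 wu1 awu1) -/z; last first.
  by rewrite in_itv/= tb lexx.
have b0 := le_trans t0 tb.
have cwb := controlsS tb (lexx T) cw; have cawb := controlsS tb (lexx T) caw.
rewrite (payoff_ae hyps z b0 bT cwb cawb cv cawb)//.
  exact: eq_ae_on_concatr.
exact: aeW.
Qed.

(** Strictness is what yields, for each restricted head, an actual continuation securing the level
    [w]: a supremum exceeding [w] has a member exceeding it. *)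
Lemma upper_value_ge_tail (w : R) alpha :
  strategies_le T U1 U2 rho2 t b r alpha ->
  (forall u1, controls_le T U1 rho1 t b r u1 ->
    w%:E < running t b x u1 (alpha u1) + V b (traj t x u1 (alpha u1) b))%E ->
  (w%:E <= ereal_sup
    [set ereal_inf [set pay t x u1 (alpha u1) | u1 in controls_le T U1 rho1 t b r]
    | alpha in strategies_le T U1 U2 rho2 t b r])%E.
Proof.
move=> [sal ale] wlt; have [cal nal] := sal.
have b0 := le_trans t0 tb.
(* From the state reached under [v], the tail strategy [beta] secures the total level [w] against
   every control of Player 1. *)
pose good v beta := forall u1, controls T U1 b u1 -> (w%:E <=
  running t b x v (alpha v) + pay b (traj t x v (alpha v) b) u1 (beta u1))%E.
have /choice[beta betaP] : forall v, exists beta, strategies T U1 U2 b beta /\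
    (controls_le T U1 rho1 t b r v -> good v beta).
  move=> v; have [vle|nle] := pselect (controls_le T U1 rho1 t b r v); last first.
    (* Gluing needs a strategy for every key; outside the restricted class the zero strategy
       serves. *)
    exists (fun _ _ => 0); split=> //; split=> [u _|u u' e _ _ _ _].
      exact: cst0_controls (sh_U2_0 hyps).
    exact: aeW.
  have [cv _] := vle; have cav := cal _ (controls_controls1 cv).
  have rfin := running_cost_fin_num hyps x t0 tb bT cv cav.
  have := wlt v vle; rewrite -lteBlDl// => /ereal_sup_gt[_ [be sbe <-] wbe].
  exists be; split=> // _ u1 cu1; rewrite -leeBlDl//.
  apply: le_trans (ltW wbe) _.
  exact: ereal_inf_lbound (ex_intro2 _ _ _ cu1 erefl).
(* A representative of the class of [u] on [t, b], taken among restricted controls. [xget] depends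
   only on the set, and equivalent controls define the same set, so their keys are equal and not
   merely equivalent. *)
pose key u := xget (fun=> 0)
  [set v | controls_le T U1 rho1 t b r v /\ eq_ae_on t b u v].
have keyE u v : eq_ae_on t b u v -> key u = key v.
  move=> uv; rewrite /key; congr xget; apply/seteqP.
  split=> z /= [zle e]; (split; first exact: zle).
    exact: eq_ae_on_trans (eq_ae_on_sym uv) e.
  exact: eq_ae_on_trans uv e.
pose gamma u := concat b (alpha u) (beta (key u) u).
have sgamma : strategies T U1 U2 t gamma.
  by apply: glued_strategy => // k; case: (betaP k).
have gamma_le : strategies_le T U1 U2 rho2 t b r gamma.
  split; first exact: sgamma.
  move=> u cu; apply: (controls_le_ae bT _ (sgamma.1 u cu) (ale u cu)).
  exact/eq_ae_on_sym/eq_ae_on_concatl.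
apply: le_trans (ereal_sup_ubound (ex_intro2 _ _ _ gamma_le erefl)).
apply: le_ereal_inf_tmp => _ [u ule <-].
have [cu _] := ule; have c1u := controls_controls1 cu.
(* A restricted [u] belongs to its own class, so the default of [xget] does not occur here. *)
have [vle uv] : controls_le T U1 rho1 t b r (key u) /\ eq_ae_on t b u (key u).
  have uP : [set v | controls_le T U1 rho1 t b r v /\ eq_ae_on t b u v] u.
    by split; [exact: ule|exact: aeW].
  exact: (xgetI (fun=> 0) uP).
set v := key u in vle uv; have [cv _] := vle; have c1v := controls_controls1 cv.
have cau := cal _ c1u; have cav := cal _ c1v; have cgu := sgamma.1 _ c1u.
have auv : eq_ae_on t b (alpha u) (alpha v) by apply: nal => //; rewrite in_itv/= tb.
(* The play of [gamma] against [u] agrees on [t, b] with that of [alpha] against the representative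
   [v], so the level secured from the state reached under [v] is secured against [u]. *)
have guv : eq_ae_on t b (gamma u) (alpha v).
  by apply: eq_ae_on_trans auv; exact: eq_ae_on_concatl.
have [sbv /(_ vle) bvP] := betaP v.
have cub := controlsS tb (lexx T) cu; have cgub := controlsS tb (lexx T) cgu.
have cbv := sbv.1 _ (controls_controls1 cub).
apply: le_trans (bvP u cub) _.
rewrite (payoff_split hyps x t0 tb bT cu cgu).
rewrite (running_cost_prefix hyps x t0 tb bT cu cgu cv cav uv guv).
rewrite (trajectory_prefix hyps x t0 tb bT cu cgu cv cav uv guv); last first.
  by rewrite in_itv/= tb lexx.
rewrite (payoff_ae hyps _ b0 bT cub cbv cub cgub)//; first exact: aeW.
exact/eq_ae_on_sym/eq_ae_on_concatr.
Qed.

Lemma upper_value_dpp :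
  V t x = ereal_sup
    [set ereal_inf [set pay t x u1 (alpha u1) | u1 in controls_le T U1 rho1 t b r]
    | alpha in strategies_le T U1 U2 rho2 t b r] ->
  V t x = ereal_sup
    [set ereal_inf [set (running t b x u1 (alpha u1)
                         + V b (traj t x u1 (alpha u1) b))%E
                   | u1 in controls_le T U1 rho1 t b r]
    | alpha in strategies_le T U1 U2 rho2 t b r].
Proof.
move=> VE; apply/eqP; rewrite eq_le; apply/andP; split; rewrite VE.
  apply: ge_ereal_sup => _ [alpha ale <-].
  apply: le_trans (ereal_sup_ubound (ex_intro2 _ _ _ ale erefl)).
  apply: le_ereal_inf_tmp => _ [u1 u1le <-].
  exact: (inf_payoff_le_tail (proj1 ale) u1le).
rewrite leNgt; apply/negP => /ereal_sup_gt[_ [alpha ale <-]].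
(* A real level strictly above the restricted payoff value and below the guarantee of [alpha]
   contradicts [upper_value_ge_tail]. *)
move=> /ereal_lt_dense[w /andP[Vw wI]].
have := @upper_value_ge_tail w alpha ale.
rewrite leNgt Vw => /(_ _)/negP; apply=> //.
move=> u1 u1le; apply: lt_le_trans wI _.
exact: ereal_inf_lbound (ex_intro2 _ _ _ u1le erefl).
Qed.

End dynamic_programming.

(** The relation is asked only on [A] and [B], since opposite payoffs are available only for
    admissible pairs, whose running cost is integrable. *)
Lemma ereal_sup_infN (R : realType) (I J : Type) (A : set I) (B : set J)
    (P Q : I -> J -> \bar R) :
  (forall i j, A i -> B j -> Q i j = - P i j)%E ->
  ereal_sup [set ereal_inf [set Q i j | j in B] | i in A] =
  (- ereal_inf [set ereal_sup [set P i j | j in B] | i in A])%E.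
Proof.
move=> QP; rewrite -ereal_supN image_comp; congr ereal_sup.
apply: eq_imagel => i Ai /=; rewrite -ereal_infN image_comp; congr ereal_inf.
by apply: eq_imagel => j Bj /=; exact: QP.
Qed.

(** * Exchange of the players and the lower value *)

Section duality.
Context (R : realType) (n m1 m2 : nat) (T : R).
Context (U1 : set 'rV[R]_m1) (U2 : set 'rV[R]_m2).
Context (f : R -> 'rV[R]_n -> 'rV[R]_m1 -> 'rV[R]_m2 -> 'rV[R]_n).
Context (g : R -> 'rV[R]_n -> 'rV[R]_m1 -> 'rV[R]_m2 -> R).
Context (h : 'rV[R]_n -> R).
Context (L c rho1 rho2 sigma1 sigma2 mu mu0 mu1 mu2 : R).
Hypothesis hyps : standing_hyps T U1 U2 f g h
  L c rho1 rho2 sigma1 sigma2 mu mu0 mu1 mu2.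

Let f' s y a2 a1 := f s y a1 a2.
Let g' s y a2 a1 := - g s y a1 a2.
Let h' y := - h y.

Lemma within_continuous_swap (Z : topologicalType)
    (F : R -> 'rV[R]_n -> 'rV[R]_m1 -> 'rV[R]_m2 -> Z) :
  {within `[0, T] `*` [set: 'rV[R]_n] `*` U1 `*` U2,
    continuous (fun p => F p.1.1.1 p.1.1.2 p.1.2 p.2)} ->
  {within `[0, T] `*` [set: 'rV[R]_n] `*` U2 `*` U1,
    continuous (fun p => F p.1.1.1 p.1.1.2 p.2 p.1.2)}.
Proof.
move=> /subspace_continuousP cF; apply/subspace_continuousP.
move=> -[[[s y] a2] a1] [[[/= sT _] Ua2] Ua1] A nA.
pose swap (q : R * 'rV[R]_n * 'rV[R]_m2 * 'rV[R]_m1) :=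
  (q.1.1.1, q.1.1.2, q.2, q.1.2).
(* Balls of the product are defined factor by factor, so the swap preserves the radius. *)
have cswap : swap q @[q --> (s, y, a2, a1)] --> (s, y, a1, a2).
  move=> B; rewrite -nbhs_ballE => -[e /= e0 eB].
  suff : nbhs (s, y, a2, a1) (swap @^-1` B) by [].
  rewrite -nbhs_ballE; exists e => // q [[[b1 b2] b3] b4].
  by apply: eB.
have FA := cF (s, y, a1, a2) (conj (conj (conj sT I) Ua1) Ua2) A nA.
apply: (@filterS _ (nbhs (s, y, a2, a1)) _ _ _ _ (cswap _ FA)).
move=> -[[[s' y'] a2'] a1'] /= HA [[[/= s'T _] Ua2'] Ua1'].
exact: HA.
Qed.

(** The hypotheses are symmetric in the players: negating [g] interchanges its two coercivity
    bounds, with the same constants. *)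
Lemma standing_hyps_swap : standing_hyps T U2 U1 f' g' h'
  L c rho2 rho1 sigma2 sigma1 mu mu0 mu2 mu1.
Proof.
case: hyps => T0 L0 c0 r1 r2 s1 s2 mu_ge1 cU1 U10 cU2 U20 cf fg fl fm cg gl gu glip.
move=> ch hl h0 co1 co2; split=> //.
- exact: (within_continuous_swap cf).
- by move=> s y a2 a1 sT Ua2 Ua1; rewrite addrAC; exact: fg.
- by move=> s y z a2 a1 sT Ua2 Ua1; rewrite addrAC; exact: fl.
- by move=> s y z a2 a1 sT Ua2 Ua1; exact: fm.
- apply: (within_continuous_swap (F := fun s y a1 a2 => - g s y a1 a2)).
  by move=> p; apply: cvgN; exact: cg.
- by move=> s y a2 a1 sT Ua2 Ua1; rewrite lerNr opprB; exact: gu.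
- by move=> s y a2 a1 sT Ua2 Ua1; rewrite lerNl opprB; exact: gl.
- move=> s y z a2 a1 sT Ua2 Ua1; rewrite addrAC /g' -opprD normrN.
  exact: glip.
- move=> y; exact: (@cvgN _ _ _ _ _ _ _ (ch y)).
- by move=> y z; rewrite /h' -opprD normrN; exact: hl.
- by rewrite /h' normrN.
Qed.

Local Notation leb := (@lebesgue_measure R).

Lemma running_cost_swap t b x u1 u2 : 0 <= t -> t <= b -> b <= T ->
  controls T U1 t u1 -> controls T U2 t u2 ->
  running_cost T f' g' t b x u2 u1 = (- running_cost T f g t b x u1 u2)%E.
Proof.
move=> t0 tb bT cu1 cu2.
have iy := integrable_running hyps x t0 (le_trans tb bT) cu1 cu2.
rewrite /running_cost -integralN//.
exact: integrable_add_def (integrable_subsegment bT iy).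
Qed.

Lemma payoff_swap t x u1 u2 : 0 <= t -> t <= T ->
  controls T U1 t u1 -> controls T U2 t u2 ->
  payoff T f' g' h' t x u2 u1 = (- payoff T f g h t x u1 u2)%E.
Proof.
move=> t0 tT cu1 cu2; rewrite /payoff running_cost_swap//.
move: (running_cost _ _ _ _ _ _ _ _) => A.
by rewrite [RHS]oppeD//; exact: fin_num_adde_defl.
Qed.

(** In the exchanged game Player 2 moves in first position, so strategies and controls range over
    the same sets on both sides and only the payoff changes sign. *)
Lemma lower_value_dual t x : 0 <= t -> t <= T ->
  lower_value T U1 U2 f g h t x = (- upper_value T U2 U1 f' g' h' t x)%E.
Proof.
move=> t0 tT; rewrite /upper_value /lower_value.
rewrite (ereal_sup_infN (P := fun alpha u2 => payoff T f g h t x (alpha u2) u2)).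
  by rewrite oppeK.
move=> alpha u2 [cal _] cu2; apply: payoff_swap => //.
exact/cal/controls_controls1.
Qed.

Lemma lower_value_dpp (t b r : R) x : 0 <= t -> t <= b -> b <= T ->
  lower_value T U1 U2 f g h t x = ereal_inf
    [set ereal_sup [set payoff T f g h t x (alpha u2) u2
                   | u2 in controls_le T U2 rho2 t b r]
    | alpha in strategies_le T U2 U1 rho1 t b r] ->
  lower_value T U1 U2 f g h t x = ereal_inf
    [set ereal_sup [set (running_cost T f g t b x (alpha u2) u2
                         + lower_value T U1 U2 f g h b
                             (trajectory T f t x (alpha u2) u2 b))%E
                   | u2 in controls_le T U2 rho2 t b r]
    | alpha in strategies_le T U2 U1 rho1 t b r].
Proof.
move=> t0 tb bT; have tT := le_trans tb bT; have b0 := le_trans t0 tb.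
rewrite lower_value_dual// => VE.
have cal alpha u2 : strategies_le T U2 U1 rho1 t b r alpha ->
    controls_le T U2 rho2 t b r u2 -> controls T U1 t (alpha u2).
  by move=> [[cal _] _] [cu2 _]; exact/cal/controls_controls1.
rewrite (upper_value_dpp standing_hyps_swap t0 tb bT (r := r)).
  rewrite (ereal_sup_infN (P := fun alpha u2 =>
      (running_cost T f g t b x (alpha u2) u2 + lower_value T U1 U2 f g h b
        (trajectory T f t x (alpha u2) u2 b))%E)); first by rewrite oppeK.
  move=> alpha u2 ale u2le; have cau2 := cal _ _ ale u2le; have [cu2 _] := u2le.
  rewrite running_cost_swap// lower_value_dual//.
  (* Finiteness of the running cost allows the sign to be distributed over the sum even if the lower
     value at [b] is infinite. *)
  have rfin := running_cost_fin_num hyps x t0 tb bT cau2 cu2.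
  move: (running_cost _ _ _ _ _ _ _ _) rfin => A rfin.
  by rewrite [RHS]oppeD ?oppeK//; exact: fin_num_adde_defr.
rewrite (ereal_sup_infN (P := fun alpha u2 => payoff T f g h t x (alpha u2) u2)).
  by rewrite -VE oppeK.
move=> alpha u2 ale u2le; have cau2 := cal _ _ ale u2le; have [cu2 _] := u2le.
exact: payoff_swap.
Qed.

End duality.

Theorem theorem5p5 (R : realType) (n m1 m2 : nat) (T : R)
    (U1 : set 'rV[R]_m1) (U2 : set 'rV[R]_m2)
    (f : R -> 'rV[R]_n -> 'rV[R]_m1 -> 'rV[R]_m2 -> 'rV[R]_n)
    (g : R -> 'rV[R]_n -> 'rV[R]_m1 -> 'rV[R]_m2 -> R)
    (h : 'rV[R]_n -> R)
    (L c rho1 rho2 sigma1 sigma2 mu mu0 mu1 mu2 : R)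
    (hyps : standing_hyps T U1 U2 f g h
              L c rho1 rho2 sigma1 sigma2 mu mu0 mu1 mu2)
    (t tbar : R) (x : 'rV[R]_n)
    (t_ge0 : 0 <= t) (t_ltT : t < T)
    (t_lt_tbar : t < tbar) (tbar_leT : tbar <= T)
    (N : R -> R)
    (N_ge0 : forall r, 0 <= r -> 0 <= N r)
    (N_nondecreasing : forall r s, 0 <= r -> r <= s -> N r <= N s)
    (N_continuous : {within [set r | 0 <= r], continuous N})
    (upper_restricted :
      upper_value T U1 U2 f g h t x =
      ereal_sup
        [set ereal_inf
               [set payoff T f g h t x u1 (alpha2 u1)
               | u1 in controls_le T U1 rho1 t tbar (N (enorm x))]
        | alpha2 in strategies_le T U1 U2 rho2 t tbar (N (enorm x))])
    (lower_restricted :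
      lower_value T U1 U2 f g h t x =
      ereal_inf
        [set ereal_sup
               [set payoff T f g h t x (alpha1 u2) u2
               | u2 in controls_le T U2 rho2 t tbar (N (enorm x))]
        | alpha1 in strategies_le T U2 U1 rho1 t tbar (N (enorm x))]) :
  upper_value T U1 U2 f g h t x =
    ereal_sup
      [set ereal_inf
             [set (running_cost T f g t tbar x u1 (alpha2 u1)
                   + upper_value T U1 U2 f g h tbar
                       (trajectory T f t x u1 (alpha2 u1) tbar))%E
             | u1 in controls_le T U1 rho1 t tbar (N (enorm x))]
      | alpha2 in strategies_le T U1 U2 rho2 t tbar (N (enorm x))]
  /\
  lower_value T U1 U2 f g h t x =
    ereal_inf
      [set ereal_sup
             [set (running_cost T f g t tbar x (alpha1 u2) u2
                   + lower_value T U1 U2 f g h tbar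
                       (trajectory T f t x (alpha1 u2) u2 tbar))%E
             | u2 in controls_le T U2 rho2 t tbar (N (enorm x))]
      | alpha1 in strategies_le T U2 U1 rho1 t tbar (N (enorm x))].
Proof.
have t_le_tbar := ltW t_lt_tbar; split.
  exact: (upper_value_dpp hyps t_ge0 t_le_tbar tbar_leT upper_restricted).
exact: (lower_value_dpp hyps t_ge0 t_le_tbar tbar_leT lower_restricted).
Qed.
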